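(* Assume that $H_0$ is true, i.e. $\mathbf X$ and $\mathbf Y$ are conditionally independent given $\mathbf Z$, and that the conditional distribution of $\mathbf X$ given $\mathbf Z$ is $P_{\mathbf X\mid\mathbf Z}$. Let $\mathbf X^{(1)}$ be copies of $\mathbf X$ generated using an estimate $Q^{(n)}_{\mathbf X\mid\mathbf Z}$ of the true conditional distribution $P_{\mathbf X\mid\mathbf Z}$. Then, for any desired Type I error rate $\alpha\in[0,1]$, $$\mathbb P\{p_{n,B}\le\alpha\mid(\mathbf Y_i,\mathbf Z_i)_{i=1}^n\}\le\frac{\lfloor(B+1)\alpha\rfloor}{B+1}+d_{\mathrm{TV}}\Big(\prod_{i=1}^nQ^{(n)}_{\mathbf X\mid\mathbf Z_i},\ \prod_{i=1}^nP_{\mathbf X\mid\mathbf Z_i}\Big),$$ where $d_{\mathrm{TV}}(Q_1,Q_2)=\sup_A|Q_1(A)-Q_2(A)|$, $p_{n,B}$ is the randomized $p$-value computed with the copies $\mathbf X^{(1)}$, and the probability is taken with respect to the distribution of $\mathbf X$ and $\mathbf X^{(1)}$ conditional on $\mathbf Y,\mathbf Z$.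
   Context: $\{(\mathbf X_i,\mathbf Y_i,\mathbf Z_i)\}_{i=1}^n$ is an i.i.d. sample of the random vector $(\mathbf X,\mathbf Y,\mathbf Z)$ in $\mathbb R^d$. Instead of assuming knowledge of $P_{\mathbf X\mid\mathbf Z}$, an approximation $Q^{(n)}_{\mathbf X\mid\mathbf Z}$ is used: $\mathbf X_i^{(1)}\sim Q^{(n)}_{\mathbf X\mid\mathbf Z_i}$ for $i=1,\dots,n$. For example, $Q^{(n)}_{\mathbf X\mid\mathbf Z}$ may be an estimate of $P_{\mathbf X\mid\mathbf Z}$ constructed either from the same data or from an auxiliary unlabeled sample $\{(\mathbf X_i^*,\mathbf Z_i^* )\}_{i=1}^N$ drawn from the joint distribution of $(\mathbf X,\mathbf Z)$. Fix $\sigma^2>0$ and $K(\mathbf x,\mathbf y)=\exp\{-\sigma^2\|\mathbf x-\mathbf y\|^2/2\}$. With $\mathbf V_i=(\mathbf X_i,\mathbf Y_i,\mathbf Z_i)$ and $\mathbf V_i^{(1)}=(\mathbf X_i^{(1)},\mathbf Y_i,\mathbf Z_i)$, let $$\hat\zeta_{n,\sigma}=\binom n2^{-1}\sum_{1\le i<j\le n}\big\{K(\mathbf V_i,\mathbf V_j)+K(\mathbf V_i^{(1)},\mathbf V_j^{(1)})-K(\mathbf V_i,\mathbf V_j^{(1)})-K(\mathbf V_i^{(1)},\mathbf V_j)\big\}.$$ For $\pi\in\{0,1\}^n$, $\hat\zeta_{n,\sigma}(\pi)$ is the same statistic with $(\mathbf X_i,\mathbf X_i^{(1)})$ replaced by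 $(\pi(i)\mathbf X_i+(1-\pi(i))\mathbf X_i^{(1)},\ (1-\pi(i))\mathbf X_i+\pi(i)\mathbf X_i^{(1)})$ for each $i$. With $\pi_1,\dots,\pi_B$ generated independently and uniformly from $\{0,1\}^n$, $$p_{n,B}=\frac1{B+1}\Big(\sum_{i=1}^B\mathrm I\{\hat\zeta_{n,\sigma}(\pi_i)\ge\hat\zeta_{n,\sigma}\}+1\Big).$$ *)

(* Defs.v *)
From HB Require Import structures.
From mathcomp Require Import all_boot all_order all_algebra.
From mathcomp Require Import all_classical all_reals all_analysis.
From mathcomp Require Import measurable_realfun.

Set Implicit Arguments.
Unset Strict Implicit.
Unset Printing Implicit Defensive.

Import Order.TTheory GRing.Theory Num.Theory.
Import numFieldNormedType.Exports.

Local Open Scope classical_set_scope.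
Local Open Scope ring_scope.

(* Points of R^d are d-tuples of reals: [d.-tuple R] carries the product of the
   Borel sigma-algebras, which row vectors lack in the library. *)

Section conditioning.
Context d0 d1 (Omega : measurableType d0) (TC : measurableType d1)
  (R : realType) (P : probability Omega R).

(* g is a version of c |-> E[h | C = c]; the conditional expectation E[h | C],
   as a random variable, is then omega |-> g (C omega). *)
Definition cond_exp_version (C : Omega -> TC) (h : Omega -> \bar R)
    (g : TC -> \bar R) : Prop :=
  measurable_fun setT g /\
  forall B : set TC, measurable B ->
    (\int[P]_(w in C @^-1` B) g (C w) = \int[P]_(w in C @^-1` B) h w)%E.

Definition cond_prob_version (C : Omega -> TC) (E : set Omega)
    (g : TC -> \bar R) : Prop :=
  cond_exp_version C (fun w => (\1_E w)%:E) g.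

(* kappa is a regular conditional distribution of U given C. *)
Definition cond_law d2 (TU : measurableType d2) (U : Omega -> TU)
    (C : Omega -> TC) (kappa : TC -> set TU -> \bar R) : Prop :=
  forall A : set TU, measurable A ->
    cond_prob_version C (U @^-1` A) (kappa ^~ A).

(* P(U \in A, V \in B | C) = P(U \in A | C) P(V \in B | C) almost surely. *)
Definition cond_indep d2 (TU : measurableType d2) d3 (TV : measurableType d3)
    (U : Omega -> TU) (V : Omega -> TV) (C : Omega -> TC) : Prop :=
  forall (A : set TU) (B : set TV), measurable A -> measurable B ->
    exists f g : TC -> \bar R,
      [/\ cond_prob_version C (U @^-1` A) f,
          cond_prob_version C (V @^-1` B) g &
          cond_prob_version C (U @^-1` A `&` V @^-1` B)
            (fun c => f c * g c)%E].

End conditioning.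

Section independence.
Context d0 (Omega : measurableType d0) (R : realType)
  (P : probability Omega R).

Definition indep d1 (TU : measurableType d1) d2 (TV : measurableType d2)
    (U : Omega -> TU) (V : Omega -> TV) : Prop :=
  forall (A : set TU) (B : set TV), measurable A -> measurable B ->
    P (U @^-1` A `&` V @^-1` B) = (P (U @^-1` A) * P (V @^-1` B))%E.

(* Subfamilies are covered by taking some of the A i to be the full set. *)
Definition mutual_indep d1 (T : measurableType d1) (I : finType)
    (U : I -> Omega -> T) : Prop :=
  forall A : I -> set T, (forall i, measurable (A i)) ->
    P [set w | forall i, A i (U i w)] = (\prod_i P (U i @^-1` A i))%E.

Definition same_law d1 (T : measurableType d1) (U V : Omega -> T) : Prop :=
  forall A : set T, measurable A -> P (U @^-1` A) = P (V @^-1` A).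

Definition iid_sample_of d1 (T : measurableType d1) (I : finType)
    (U : I -> Omega -> T) (V : Omega -> T) : Prop :=
  mutual_indep U /\ forall i, same_law (U i) V.

Definition uniform_bits n (U : Omega -> n.-tuple bool) : Prop :=
  forall s : n.-tuple bool, P (U @^-1` [set s]) = ((2 ^+ n)^-1)%:E.

End independence.

Definition rvtuple (Omega T : Type) n (U : 'I_n -> Omega -> T) (w : Omega)
  : n.-tuple T := [tuple U i w | i < n].

Section product_probability.
Context d (T : measurableType d).

Definition cons_pair n (xt : T * n.-tuple T) : n.+1.-tuple T :=
  [the n.+1.-tuple T of xt.1 :: xt.2].

Lemma measurable_cons_pair n : measurable_fun setT (@cons_pair n).
Proof. exact: measurable_cons. Qed.

HB.instance Definition _ n :=
  isMeasurableFun.Build _ _ _ _ (@cons_pair n) (@measurable_cons_pair n).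

Context (R : realType).

(* The product of m 0, ..., m (n-1), as a probability on n-tuples. *)
Fixpoint prod_prob n : ('I_n -> probability T R) -> probability (n.-tuple T) R :=
  match n with
  | 0 => fun _ => \d_([tuple] : 0.-tuple T)
  | k.+1 => fun m => distribution
      (m ord0 \x prod_prob (fun i : 'I_k => m (lift ord0 i)))%E (@cons_pair k)
  end.

Definition dTV (m1 m2 : set T -> \bar R) : \bar R :=
  ereal_sup [set `|m1 A - m2 A|%E | A in [set A | measurable A]].

End product_probability.

Section kernel_probability.
Context d1 (S : measurableType d1) d2 (T : measurableType d2) (R : realType).
Variable k : R.-pker S ~> T.

(* The library equips k x with a structure of measure only; this alias of k x
   is also a probability. *)
Definition kernel_prob (x : S) : set T -> \bar R := k x.

HB.instance Definition _ x := Measure.on (kernel_prob x).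
HB.instance Definition _ x :=
  Measure_isProbability.Build _ _ _ (kernel_prob x) (prob_kernel x).

End kernel_probability.

Section statistic.
Context (R : realType).

Definition gauss_kernel (sigma : R) d (x y : d.-tuple R) : R :=
  expR (- (sigma ^+ 2 * (\sum_(k < d) (tnth x k - tnth y k) ^+ 2) / 2)).

Definition zeta_stat (sigma : R) n d (V V1 : 'I_n -> d.-tuple R) : R :=
  let K := @gauss_kernel sigma d in
  ('C(n, 2)%:R)^-1 *
  \sum_(i < n) \sum_(j < n | (i < j)%N)
    (K (V i) (V j) + K (V1 i) (V1 j) - K (V i) (V1 j) - K (V1 i) (V j)).

Context (n dX dY dZ : nat).

Definition zeta_hat (sigma : R) (X X1 : 'I_n -> dX.-tuple R)
    (Y : 'I_n -> dY.-tuple R) (Z : 'I_n -> dZ.-tuple R) : R :=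
  zeta_stat sigma
    (fun i => cat_tuple (cat_tuple (X i) (Y i)) (Z i))
    (fun i => cat_tuple (cat_tuple (X1 i) (Y i)) (Z i)).

Definition zeta_hat_swap (sigma : R) (X X1 : 'I_n -> dX.-tuple R)
    (Y : 'I_n -> dY.-tuple R) (Z : 'I_n -> dZ.-tuple R)
    (s : n.-tuple bool) : R :=
  zeta_hat sigma
    (fun i => if tnth s i then X i else X1 i)
    (fun i => if tnth s i then X1 i else X i) Y Z.

Definition pvalue (sigma : R) (X X1 : 'I_n -> dX.-tuple R)
    (Y : 'I_n -> dY.-tuple R) (Z : 'I_n -> dZ.-tuple R)
    B (s : 'I_B -> n.-tuple bool) : R :=
  (B.+1%:R)^-1 *
  (\sum_(b < B) (zeta_hat sigma X X1 Y Z
                   <= zeta_hat_swap sigma X X1 Y Z (s b))%R%:R + 1).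

End statistic.

(* Main.v *)
Require Import Defs.
From HB Require Import structures.
From mathcomp Require Import all_boot all_order all_algebra.
From mathcomp Require Import all_classical all_reals all_analysis.
From mathcomp Require Import measurable_realfun perm lra.


(** Suppose first that the copies were drawn from the true conditional law.
    Given (Y_i, Z_i)_i the originals and the copies would then be exchangeable
    in each position, so swapping them according to an extra uniform bit
    vector s would change nothing. After this swap the observed statistic is
    the value at s of a function of bit vectors, and the B resampled
    statistics are the values of the same function at B further independent
    uniform vectors. The observed value is thus one of B + 1 exchangeable
    numbers, and the event that the p-value is at most alpha says that it is
    among the floor((B + 1) alpha) largest ones. This gives the first term of
    the bound: [card_upper_rank_le] and [upper_rank_exchangeable] are the
    counting, [swap_tuples_invariant] the exchangeability and
    [avg_rejection_le] the conclusion.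

    The actual copies are drawn from the estimate. For fixed seeds and fixed
    values of everything but the copies, rejection is an event about the
    copies, and its probabilities under the estimated and the true law differ
    by at most the total variation distance ([le_dTV]).

    The rest is conditioning. A conditional law is handled through its action
    on measurable subsets of the product of the conditioning space and the
    target ([disintegrates]); such identities extend from rectangles by
    Dynkin's theorem ([disintegrates_pi]). Conditional independence of X and Y
    given Z and the i.i.d. assumption show that the originals follow the
    product of the true conditional laws given (Y_i, Z_i)_i
    ([disintegrates_cond_indep], [disintegrates_iid], [disintegrates_sample]),
    and [disintegrates_copy] adds a draw that depends on the conditioning
    value only. If the estimate is conditionally independent of the originals,
    one conditions on it as well and gets the bound with the distance itself
    ([validity_given_data]). Otherwise the law of the copies is replaced
    before the originals are averaged out, and the distance appears through
    its conditional expectation ([validity_averaged]). *)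

Set Implicit Arguments.
Unset Strict Implicit.
Unset Printing Implicit Defensive.

Import Order.TTheory GRing.Theory Num.Theory.
Import numFieldNormedType.Exports.

Local Open Scope classical_set_scope.
Local Open Scope ring_scope.

(** * Generating pi-systems *)

Section pi_generators.

Lemma measurable_preimageT d1 d2 (T1 : measurableType d1) (T2 : measurableType d2)
  (f : T1 -> T2) (A : set T2) :
  measurable_fun setT f -> measurable A -> measurable (f @^-1` A).
Proof. by move=> mf mA; rewrite -[X in measurable X]setTI; exact: mf. Qed.

Definition pi_generator d (T : measurableType d) (G : set (set T)) : Prop :=
  [/\ @measurable d T = <<s G >>, setI_closed G & G setT].

Lemma pi_generator_measurable d (T : measurableType d) :
  pi_generator (@measurable d T).
Proof.
split; [|exact: measurableI|exact: measurableT].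
by apply/esym/sigma_algebra_id; exact: sigma_algebra_measurable.
Qed.

Lemma sub_pi_generator d (T : measurableType d) (G : set (set T)) A :
  pi_generator G -> G A -> measurable A.
Proof. by move=> [-> _ _]; exact: sub_sigma_algebra. Qed.

Lemma preimage_g_sigma d (T1 : measurableType d) (T2 : Type) (G : set (set T1))
    (f : T2 -> T1) (H : set (set T2)) :
  @measurable d T1 = <<s G >> -> (forall A, G A -> <<s H >> (f @^-1` A)) ->
  forall A, measurable A -> <<s H >> (f @^-1` A).
Proof.
move=> mG GH A; rewrite mG => GA.
have : <<s G >> `<=` [set A | <<s H >> (f @^-1` A)].
  apply: smallest_sub => //; split => /=.
  - by rewrite preimage_set0; exact: sigma_algebra0.
  - by move=> B HB; rewrite setTD preimage_setC -setTD; exact: sigma_algebraCD.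
  - by move=> F HF; rewrite preimage_bigcup; exact: sigma_algebra_bigcup.
exact.
Qed.

(** Since both classes contain the full set, the cylinders that generate the
    product sigma-algebra are among the products of their members. *)
Lemma pi_generator_prod d1 (T1 : measurableType d1) d2 (T2 : measurableType d2)
    (G1 : set (set T1)) (G2 : set (set T2)) :
  pi_generator G1 -> pi_generator G2 ->
  pi_generator [set A `*` B | A in G1 & B in G2].
Proof.
move=> pG1 pG2; have [mG1 I1 T1G] := pG1; have [mG2 I2 T2G] := pG2; split.
- apply/seteqP; split.
    apply: smallest_sub; first exact: smallest_sigma_algebra.
    rewrite subUset; split=> _ [A mA <-]; rewrite setTI.
      apply: (preimage_g_sigma mG1) => // B GB; apply: sub_sigma_algebra.
      by exists B => //; exists setT => //; rewrite setXT.
    apply: (preimage_g_sigma mG2) => // B GB; apply: sub_sigma_algebra.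
    by exists setT => //; exists B => //; rewrite setTX.
  apply: smallest_sub; first exact: sigma_algebra_measurable.
  move=> _ [A GA] [B GB] <-; apply: measurableX.
    exact: (sub_pi_generator pG1).
  exact: (sub_pi_generator pG2).
- move=> _ _ [A GA] [B GB] <- [A' GA'] [B' GB'] <-.
  by exists (A `&` A'); [exact: I1|exists (B `&` B'); [exact: I2|rewrite setXI]].
- by exists setT => //; exists setT => //; rewrite setXTT.
Qed.

Definition box (T : Type) n (A : 'I_n -> set T) : set (n.-tuple T) :=
  [set t | forall i, A i (tnth t i)].

Lemma boxE (T : Type) n (A : 'I_n -> set T) :
  box A = \bigcap_i ((@tnth n T ^~ i) @^-1` A i).
Proof. by apply/seteqP; split=> [t At i _|t At i]; exact: At. Qed.

Lemma measurable_box d (T : measurableType d) n (A : 'I_n -> set T) :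
  (forall i, measurable (A i)) -> measurable (box A).
Proof.
move=> mA; rewrite boxE; apply: fin_bigcap_measurable; first exact: finite_finset.
by move=> i _; rewrite -[X in measurable X]setTI; exact: measurable_tnth.
Qed.

Lemma pi_generator_box d (T : measurableType d) n :
  pi_generator [set box A | A in [set A : 'I_n -> set T |
                                    forall i, measurable (A i)]].
Proof.
split.
- apply/seteqP; split.
    apply: smallest_sub; first exact: smallest_sigma_algebra.
    move=> B; rewrite -bigcup_seq => -[i _ [A mA <-]]; rewrite setTI.
    apply: sub_sigma_algebra; exists (fun j => if j == i then A else setT).
      by move=> j; case: ifP.
    apply/seteqP; split=> [t /(_ i)|t /= At j]; first by rewrite eqxx.
    by case: eqP => // ->.
  apply: smallest_sub; first exact: sigma_algebra_measurable.
  by move=> _ [A mA <-]; exact: measurable_box.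
- move=> _ _ [A mA <-] [B mB <-]; exists (fun i => A i `&` B i).
    by move=> i; exact: measurableI.
  by apply/seteqP; split=> [t h|t [h1 h2] i]; [split=> i; case: (h i)|split].
- by exists (fun=> setT) => //; apply/seteqP; split.
Qed.

Lemma pi_generator_unique d (T : measurableType d) (R : realType)
    (G : set (set T)) (m1 m2 : {measure set T -> \bar R}) :
  pi_generator G -> (m1 setT < +oo)%E -> (forall A, G A -> m1 A = m2 A) ->
  forall A, measurable A -> m1 A = m2 A.
Proof.
move=> [mG IG GT] m1fin m12 A; apply: (measure_unique G (fun=> setT)) => //.
by rewrite bigcup_const.
Qed.

End pi_generators.

Lemma emeasurable_prod d (T : measurableType d) (R : realType) (I : Type)
    (s : seq I) (f : I -> T -> \bar R) :
  (forall i, measurable_fun setT (f i)) ->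
  measurable_fun setT (fun t => \prod_(i <- s) f i t)%E.
Proof.
move=> mf; elim: s => [|i s IH].
  by under eq_fun do rewrite big_nil; exact: measurable_cst.
by under eq_fun do rewrite big_cons; exact: emeasurable_funM.
Qed.

Section product_of_probabilities.
Context d (T : measurableType d) (R : realType).
Local Open Scope ereal_scope.

(** Tonelli peels off the first coordinate. *)
Lemma integral_prod_prob n (m : 'I_n -> probability T R)
    (f : 'I_n -> T -> \bar R) :
  (forall i, measurable_fun setT (f i)) -> (forall i x, 0 <= f i x) ->
  \int[prod_prob m]_t (\prod_(i < n) f i (tnth t i)) =
  \prod_(i < n) \int[m i]_x f i x.
Proof.
elim: n m f => [|n IH] m f mf f0.
  rewrite big_ord0; under eq_integral do rewrite big_ord0.
  by rewrite integral_cst//= diracT mule1.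
have mprod k (g : 'I_k -> T -> \bar R) : (forall i, measurable_fun setT (g i)) ->
    measurable_fun setT (fun t : k.-tuple T => \prod_(i < k) g i (tnth t i)).
  move=> mg; apply: emeasurable_prod => i.
  by apply: measurableT_comp => //; exact: measurable_tnth.
rewrite /= ge0_integral_pushforward//; last 2 first.
- exact: mprod.
- by move=> t _; apply: prode_ge0 => i _; exact: f0.
rewrite preimage_setT fubini_tonelli1/=; last 2 first.
- apply: measurableT_comp; first exact: mprod.
  exact: measurable_cons_pair.
- by move=> t; apply: prode_ge0 => i _; exact: f0.
rewrite big_ord_recl -IH//.
rewrite -ge0_integralZr//; last first.
  by apply: integral_ge0 => t _; apply: prode_ge0 => i _; exact: f0.
apply: eq_integral => x _; rewrite /fubini_F/= -ge0_integralZl//; last 2 first.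
- by apply: (mprod _ (fun i => f (lift ord0 i))) => i; exact: mf.
- by move=> t _; apply: prode_ge0 => i _; exact: f0.
apply: eq_integral => t _; rewrite big_ord_recl tnth0; congr (_ * _).
by apply: eq_bigr => i _; rewrite tnthS.
Qed.

(** The indicator of a box is the product of the indicators of its sides. *)
Lemma prod_prob_box n (m : 'I_n -> probability T R) (A : 'I_n -> set T) :
  (forall i, measurable (A i)) ->
  prod_prob m (box A) = \prod_(i < n) m i (A i).
Proof.
move=> mA; under eq_bigr do rewrite -(setIT (A _)) -integral_indic//.
rewrite -integral_prod_prob//; last first.
  by move=> i; apply/measurable_EFinP; exact: measurable_indic.
rewrite -[X in prod_prob m X](setIT (box A)) -integral_indic//; last exact: measurable_box.
apply: eq_integral => t _; rewrite prodEFin; congr EFin.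
rewrite indicE; have [/[!inE] tA|/negP tA] := boolP (t \in box A).
  by rewrite big1// => i _; rewrite indicE mem_set.
have [i Ai] : exists i, ~ A i (tnth t i).
  by apply: contrapT => /forallNP h; apply: tA; rewrite inE => i; exact: contrapT.
by rewrite (bigD1 i)//= indicE memNset// mul0r.
Qed.

End product_of_probabilities.

(** * Versions of conditional expectations *)

Section versions.
Context d0 d1 (Omega : measurableType d0) (TC : measurableType d1)
  (R : realType) (P : probability Omega R) (C : Omega -> TC).
Hypothesis mC : measurable_fun setT C.
Local Open Scope ereal_scope.

Let mpre (B : set TC) : measurable B -> measurable (C @^-1` B).
Proof. exact: measurable_preimageT. Qed.

(** The integral over the set where g is negative is nonpositive, and it is
    nonnegative by hypothesis; so the negative part vanishes. *)
Lemma version_integrable (g : TC -> \bar R) : measurable_fun setT g ->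
  (forall B, measurable B -> 0 <= \int[P]_(w in C @^-1` B) g (C w) < +oo) ->
  P.-integrable setT (g \o C).
Proof.
move=> mg g0; have mgC : measurable_fun setT (g \o C) by exact: measurableT_comp.
apply/integrableP; split=> //.
(* The integral of |g| is split along the sign of g. *)
pose N := [set c | g c < 0].
have mN : measurable N.
  by rewrite /N -[X in measurable X]setTI; exact: emeasurable_fun_infty_o.
rewrite -(setUv (C @^-1` N)) ge0_integral_setU//; first last.
- by apply/disj_setPS; rewrite setICr.
- by rewrite setUv; exact: measurableT_comp.
- by rewrite preimage_setC; apply/mpre/measurableC.
- exact: mpre.
rewrite lte_add_pinfty//.
  have /andP[+ _] := g0 _ mN.
  have -> : \int[P]_(w in C @^-1` N) g (C w) =
            \int[P]_(w in C @^-1` N) - `|(g \o C) w|.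
    apply: eq_integral => w; rewrite inE => /= gw.
    by rewrite lte0_abs ?oppeK.
  by rewrite integral_ge0N// oppe_ge0 => /le_lt_trans; apply.
have /andP[_] := g0 _ (measurableC mN).
apply: le_lt_trans; rewrite le_eqVlt; apply/orP; left; apply/eqP.
apply: eq_integral => w; rewrite inE/= => /negP; rewrite -leNgt => gw.
by rewrite gee0_abs.
Qed.

(** On the set where g < f the hypothesis forces the two integrals to agree,
    so the positive function f - g vanishes almost everywhere there. *)
Lemma ae_le_version (f g : TC -> \bar R) :
  measurable_fun setT f -> measurable_fun setT g ->
  P.-integrable setT (f \o C) -> P.-integrable setT (g \o C) ->
  (forall B, measurable B ->
    \int[P]_(w in C @^-1` B) f (C w) <= \int[P]_(w in C @^-1` B) g (C w)) ->
  {ae P, forall w, f (C w) <= g (C w)}.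
Proof.
move=> mf mg intf intg fg.
pose D := [set c | g c < f c].
have mD : measurable D.
  by rewrite /D -[X in measurable X]setTI; exact: measurable_lte.
have mCD := mpre mD.
have intfD : P.-integrable (C @^-1` D) (f \o C) by exact: integrableS intf.
have intgD : P.-integrable (C @^-1` D) (g \o C) by exact: integrableS intg.
have fgD : \int[P]_(w in C @^-1` D) f (C w) = \int[P]_(w in C @^-1` D) g (C w).
  apply/eqP; rewrite eq_le fg//= le_integral// => w.
  by rewrite inE => /= /ltW.
have : \int[P]_(w in C @^-1` D) `|((f \o C) \- (g \o C)) w| = 0.
  rewrite (eq_integral ((f \o C) \- (g \o C))) => [|w]; last first.
    by rewrite inE => /= gf; rewrite gee0_abs// ltW// sube_gt0.
  by rewrite integralB// fgD subee//; exact: integrable_fin_num.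
move/ae_eq_integral_abs => /(_ mCD) [].
  by apply: (measurable_int P); exact: integrableB.
move=> N [mN PN sub]; exists N; split => // w /= /negP; rewrite -ltNge => gfw.
apply: sub => /= /(_ gfw)/eqP.
by rewrite gt_eqF// sube_gt0.
Qed.

Lemma ae_eq_version (h : Omega -> \bar R) (f g : TC -> \bar R) :
  (forall B, measurable B -> 0 <= \int[P]_(w in C @^-1` B) h w < +oo) ->
  cond_exp_version P C h f -> cond_exp_version P C h g ->
  {ae P, forall w, f (C w) = g (C w)}.
Proof.
move=> h0 [mf fh] [mg gh].
have intf : P.-integrable setT (f \o C).
  by apply: version_integrable => // B mB; rewrite fh// h0.
have intg : P.-integrable setT (g \o C).
  by apply: version_integrable => // B mB; rewrite gh// h0.
have fg : {ae P, forall w, f (C w) <= g (C w)}.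
  by apply: ae_le_version => // B mB; rewrite fh// gh.
have gf : {ae P, forall w, g (C w) <= f (C w)}.
  by apply: ae_le_version => // B mB; rewrite fh// gh.
by apply: filterS2 fg gf => w fgw gfw; apply/eqP; rewrite eq_le fgw.
Qed.

End versions.

Section pull_out.
Context d0 d1 (Omega : measurableType d0) (TC : measurableType d1)
  (R : realType) (P : probability Omega R) (C : Omega -> TC).
Hypothesis mC : measurable_fun setT C.
Local Open Scope ereal_scope.
Import HBNNSimple.

(** The hypothesis is the claim for indicators of sets of values of C; psi is
    an increasing limit of combinations of such indicators. *)
Lemma integral_pull_out (h1 h2 : Omega -> R) (psi : TC -> \bar R) :
  measurable_fun setT h1 -> measurable_fun setT h2 ->
  (forall w, 0 <= h1 w)%R -> (forall w, 0 <= h2 w)%R ->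
  measurable_fun setT psi -> (forall c, 0 <= psi c) ->
  (forall B, measurable B -> \int[P]_(w in C @^-1` B) (h1 w)%:E =
                             \int[P]_(w in C @^-1` B) (h2 w)%:E) ->
  \int[P]_w (psi (C w) * (h1 w)%:E) = \int[P]_w (psi (C w) * (h2 w)%:E).
Proof.
move=> mh1 mh2 h10 h20 mpsi psi0 h12.
pose g := nnsfun_approx measurableT mpsi.
have mgC n : measurable_fun setT (fun w => g n (C w)).
  by apply: measurableT_comp => //; exact: measurable_funP.
have limE (h : Omega -> R) : measurable_fun setT h -> (forall w, 0 <= h w)%R ->
    \int[P]_w (psi (C w) * (h w)%:E) =
    limn (fun n => \int[P]_w ((g n (C w))%:E * (h w)%:E)).
  move=> mh h0; rewrite -monotone_convergence//.
  - apply: eq_integral => w _; apply/esym/cvg_lim => //.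
    by apply: cvgeZr => //; exact: cvg_nnsfun_approx.
  - move=> n; apply: emeasurable_funM; apply/measurable_EFinP => //.
  - by move=> n w _; rewrite mule_ge0// lee_fin.
  - move=> w _ m n mn; rewrite lee_wpmul2r ?lee_fin//.
    exact/lefP/nd_nnsfun_approx.
rewrite !limE//; congr (limn _); apply/funext => n.
have sumE (h : Omega -> R) : measurable_fun setT h -> (forall w, 0 <= h w)%R ->
    \int[P]_w ((g n (C w))%:E * (h w)%:E) =
    \sum_(r \in range (g n)) (r%:E *
      \int[P]_(w in C @^-1` (g n @^-1` [set r])) (h w)%:E).
  move=> mh h0.
  have mind r : measurable_fun setT
      (fun w => (\1_(g n @^-1` [set r]) (C w) * h w)%:E : \bar R).
    apply/measurable_EFinP; apply: measurable_funM => //.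
    by apply: measurableT_comp => //; exact: measurable_indic.
  transitivity (\int[P]_w (\sum_(r \in range (g n)) (r%:E *
      (\1_(g n @^-1` [set r]) (C w) * h w)%:E))).
    apply: eq_integral => w _; rewrite [g n (C w)]fimfunE.
    rewrite !fsbig_finite//= -EFinM mulr_suml -sumEFin.
    by apply: eq_bigr => r _; rewrite -mulrA EFinM.
  rewrite ge0_integral_fsum//; last 2 first.
  - by move=> r; exact: measurable_funeM.
  - move=> r w _; rewrite -EFinM mulrA EFinM mule_ge0 ?lee_fin//.
    by have := nnfun_muleindic_ge0 (g n) r (C w); rewrite -EFinM lee_fin.
  apply: eq_fsbigr => r; rewrite inE => -[c _ <-].
  rewrite ge0_integralZl//; [|by move=> w _; rewrite lee_fin mulr_ge0|by rewrite lee_fin].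
  congr (_ * _); rewrite [RHS]integral_mkcond epatch_indic.
  by apply: eq_integral => w _; rewrite /= muleC -EFinM.
rewrite !sumE//; apply: eq_fsbigr => r _; congr (_ * _); exact: h12.
Qed.

End pull_out.

(** * Conditional laws *)

Section disintegration.
Context d0 (Omega : measurableType d0) d1 (TC : measurableType d1)
  d2 (TU : measurableType d2) (R : realType) (P : probability Omega R).
Local Open Scope ereal_scope.

(** Conditional law in graph form: testing U jointly with C lets the event
    depend on the conditioning value, and keeping measurability of the sections
    in the definition makes both parts extend together from a pi-system. *)
Definition disintegrates (C : Omega -> TC) (U : Omega -> TU)
    (kappa : TC -> probability TU R) : Prop :=
  forall E : set (TC * TU), measurable E ->
    measurable_fun setT (fun c => kappa c (xsection E c)) /\
    P [set w | E (C w, U w)] = \int[P]_w kappa (C w) (xsection E (C w)).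

Variables (C : Omega -> TC) (U : Omega -> TU) (kappa : TC -> probability TU R).
Hypotheses (mC : measurable_fun setT C) (mU : measurable_fun setT U).

(** Both parts survive complements, because every kappa c has mass one, and
    countable disjoint unions; Dynkin's theorem does the rest. *)
Lemma disintegrates_pi (G : set (set (TC * TU))) :
  pi_generator G ->
  (forall E, G E ->
    measurable_fun setT (fun c => kappa c (xsection E c)) /\
    P [set w | E (C w, U w)] = \int[P]_w kappa (C w) (xsection E (C w))) ->
  disintegrates C U kappa.
Proof.
move=> [mG IG GT] HG E mE.
have mCU (F : set (TC * TU)) : measurable F ->
    measurable [set w | F (C w, U w)].
  by move=> mF; rewrite -[X in measurable X]setTI; exact: measurable_fun_pair.
have mkC (F : set (TC * TU)) :
    measurable_fun setT (fun c => kappa c (xsection F c)) ->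
    measurable_fun setT (fun w => kappa (C w) (xsection F (C w))).
  by move=> mk; exact: (measurableT_comp mk).
have {mE} : <<s G >> E by rewrite -mG.
move: E.
apply: (dynkin_induction mG IG) => [|//|F mF|F mF tF].
- have xT c : kappa c (xsection setT c) = 1.
    have -> : xsection setT c = [set: TU].
      by apply/seteqP; split => // u _; exact/xsectionP.
    exact: probability_setT.
  split; first by under eq_fun do rewrite xT; exact: measurable_cst.
  under eq_integral do rewrite xT.
  by rewrite integral_cst//= mul1e; congr (P _); apply/seteqP; split.
- move=> [mk PF].
  have xC c : kappa c (xsection (~` F) c) = 1 - kappa c (xsection F c).
    have -> : xsection (~` F) c = ~` xsection F c.
      by rewrite !xsectionE preimage_setC.
    by rewrite probability_setC//; exact: measurable_xsection.
  split; first by under eq_fun do rewrite xC; exact: emeasurable_funB.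
  under eq_integral do rewrite xC.
  rewrite integralB//; last 2 first.
  + exact: finite_measure_integrable_cst.
  + apply: (le_integrable _ (mkC _ mk) _ (finite_measure_integrable_cst P 1 measurableT)) => //.
    move=> w _ /=; rewrite gee0_abs// normr1.
    by apply: probability_le1; exact: measurable_xsection.
  rewrite integral_cst//= mul1e probability_setT -PF -probability_setC//.
  exact: mCU.
- move=> HF.
  have xU c : kappa c (xsection (\bigcup_k F k) c) =
              \sum_(k <oo) kappa c (xsection (F k) c).
    rewrite xsection_bigcup measure_bigcup//.
      by apply: eq_eseriesl => i; rewrite in_setT.
      by move=> k _; exact: measurable_xsection.
    exact: trivIset_xsection.
  split.
    under eq_fun do rewrite xU.
    by apply: ge0_emeasurable_sum => // k _; exact: (HF k).1.
  under eq_integral do rewrite xU.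
  rewrite integral_nneseries//; last by move=> k; apply: mkC; exact: (HF k).1.
  have -> : [set w | (\bigcup_k F k) (C w, U w)] =
            \bigcup_k [set w | F k (C w, U w)] by [].
  rewrite measure_bigcup//.
  + rewrite (eq_eseriesl (Q := xpredT)) => [|k]; last by rewrite in_setT.
    by apply: eq_eseriesr => k _; exact: (HF k).2.
  + by move=> k _; exact: mCU.
  + apply/trivIsetP => i j _ _ ij; apply/seteqP; split=> // w [/= Fi Fj].
    have /trivIsetP/(_ i j Logic.I Logic.I ij) := tF.
    by move=> /seteqP[/(_ (C w, U w)) + _]; apply.
Qed.

Lemma cond_law_disintegrates :
  cond_law P U C (fun c => kappa c) -> disintegrates C U kappa.
Proof.
move=> HU; apply: (disintegrates_pi (pi_generator_prod
  (pi_generator_measurable TC) (pi_generator_measurable TU))).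
move=> _ [B mB] [A mA] <-; have [mk kE] := HU A mA.
have xE c : kappa c (xsection (B `*` A) c) = (\1_B c)%:E * kappa c A.
  rewrite indicE; have [cB|cB] := boolP (c \in B).
    by rewrite in_xsectionX// mul1e.
  by rewrite notin_xsectionX// measure0 mul0e.
split.
  under eq_fun do rewrite xE; apply: emeasurable_funM => //.
  by apply/measurable_EFinP; exact: measurable_indic.
have mCB := measurable_preimageT mC mB.
have mUA := measurable_preimageT mU mA.
transitivity (\int[P]_(w in C @^-1` B) kappa (C w) A).
  rewrite kE// integral_indic//; congr (P _).
  by apply/seteqP; split=> w /= [].
rewrite integral_mkcond epatch_indic; apply: eq_integral => w _.
by rewrite xE muleC.
Qed.

Lemma disintegrates_meas (A : set TU) :
  disintegrates C U kappa -> measurable A ->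
  measurable_fun setT (fun c => kappa c A).
Proof.
move=> H mA; have [+ _] := H (setT `*` A) (measurableX measurableT mA).
by under eq_fun do rewrite in_xsectionX ?inE//.
Qed.

Lemma disintegrates_rect (A : set TU) (B : set TC) :
  disintegrates C U kappa -> measurable A -> measurable B ->
  P (U @^-1` A `&` C @^-1` B) = \int[P]_(w in C @^-1` B) kappa (C w) A.
Proof.
move=> H mA mB; have [_ HE] := H (B `*` A) (measurableX mB mA).
rewrite (_ : _ `&` _ = [set w | (B `*` A) (C w, U w)]); last first.
  by apply/seteqP; split=> w [].
rewrite HE [RHS]integral_mkcond epatch_indic; apply: eq_integral => w _ /=.
rewrite indicE; have [cB|cB] := boolP (C w \in B).
  by rewrite in_xsectionX// mem_set ?mule1//; rewrite inE in cB.
rewrite notin_xsectionX// measure0 memNset ?mule0//.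
by move/mem_set; apply/negP.
Qed.

End disintegration.

Section measurable_kernels.
Context d1 (TC : measurableType d1) d2 (TU : measurableType d2) (R : realType).
Variable kappa : TC -> probability TU R.
Hypothesis mkappa :
  forall A, measurable A -> measurable_fun setT (fun c => kappa c A).
Local Open Scope ereal_scope.

Let k : TC -> {measure set TU -> \bar R} := kappa.
Let k_isKernel := isKernel.Build _ _ TC TU R k mkappa.
HB.instance Definition _ := k_isKernel.
HB.instance Definition _ :=
  Kernel_isProbability.Build _ _ TC TU R k (fun c => probability_setT (kappa c)).

Lemma measurable_kernel_xsection (E : set (TC * TU)) : measurable E ->
  measurable_fun setT (fun c => kappa c (xsection E c)).
Proof.
by move=> mE; apply: (measurable_fun_xsection_finite_kernel k); rewrite inE.
Qed.

Lemma measurable_kernel_integral (f : TC * TU -> \bar R) :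
  measurable_fun setT f -> (forall z, 0 <= f z) ->
  measurable_fun setT (fun c => \int[kappa c]_u f (c, u)).
Proof.
by move=> mf f0; exact: (@measurable_fun_integral_finite_kernel _ _ _ _ R f k).
Qed.

End measurable_kernels.

Section disintegrated_integral.
Context d0 (Omega : measurableType d0) d1 (TC : measurableType d1)
  d2 (TU : measurableType d2) (R : realType) (P : probability Omega R).
Variables (C : Omega -> TC) (U : Omega -> TU) (kappa : TC -> probability TU R).
Hypotheses (mC : measurable_fun setT C) (mU : measurable_fun setT U).
Hypothesis dis : disintegrates P C U kappa.
Local Open Scope ereal_scope.
Import HBNNSimple.

(** Tonelli for a conditional law, by approximation with simple functions. *)
Lemma disintegrates_integral (f : TC * TU -> \bar R) :
  measurable_fun setT f -> (forall z, 0 <= f z) ->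
  \int[P]_w f (C w, U w) = \int[P]_w (\int[kappa (C w)]_u f (C w, u)).
Proof.
move=> mf f0.
have mk A : measurable A -> measurable_fun setT (fun c => kappa c A).
  exact: disintegrates_meas dis.
have mCU : measurable_fun setT (fun w => (C w, U w)).
  exact: measurable_fun_pair.
pose g := nnsfun_approx measurableT mf.
have mg n : measurable_fun setT (EFin \o g n).
  by apply/measurable_EFinP; exact: measurable_funP.
have g0 n z : 0 <= (g n z)%:E by rewrite lee_fin.
have ndg m n z : (m <= n)%N -> (g m z)%:E <= (g n z)%:E.
  by move=> mn; rewrite lee_fin; exact/lefP/nd_nnsfun_approx.
have limg z : limn (fun n => (g n z)%:E) = f z.
  by apply/cvg_lim => //; exact: cvg_nnsfun_approx.
have mgc n c : measurable_fun setT (fun u => (g n (c, u))%:E).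
  by apply: (measurableT_comp (mg n)); exact: measurable_fun_pair.
have mgk n : measurable_fun setT (fun c => \int[kappa c]_u (g n (c, u))%:E).
  exact: (measurable_kernel_integral mk (f := EFin \o g n) (mg n) (g0 n)).
transitivity (limn (fun n => \int[P]_w (g n (C w, U w))%:E)).
  rewrite -monotone_convergence//.
  - by apply: eq_integral => w _; rewrite limg.
  - by move=> n; apply: (measurableT_comp (mg n)).
  - by move=> w _ m n mn; exact: ndg.
transitivity (limn (fun n =>
    \int[P]_w (\int[kappa (C w)]_u (g n (C w, u))%:E))); last first.
  rewrite -monotone_convergence//.
  - apply: eq_integral => w _; rewrite -monotone_convergence//.
      by apply: eq_integral => u _; rewrite limg.
    by move=> u _ m n mn; exact: ndg.
  - by move=> n; exact: (measurableT_comp (mgk n)).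
  - by move=> n w _; apply: integral_ge0.
  - move=> w _ m n mn; apply: ge0_le_integral => //.
    by move=> u _; exact: ndg.
congr (limn _); apply/funext => n.
have gE z : (g n z)%:E = \sum_(r \in range (g n)) (r * \1_(g n @^-1` [set r]) z)%:E.
  by rewrite [g n z]fimfunE !fsbig_finite//= sumEFin.
have mE r : measurable (g n @^-1` [set r]) by [].
have g0r r z : 0 <= (r * \1_(g n @^-1` [set r]) z)%:E.
  by have := nnfun_muleindic_ge0 (g n) r z; rewrite -EFinM.
have mI r : measurable_fun setT (fun z => (r * \1_(g n @^-1` [set r]) z)%:E).
  apply/measurable_EFinP; apply: measurable_funM => //.
transitivity (\sum_(r \in range (g n))
    (r%:E * P [set w | (g n @^-1` [set r]) (C w, U w)])).
  under eq_integral do rewrite gE.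
  rewrite ge0_integral_fsum//; last by move=> r; exact: (measurableT_comp (mI r)).
  apply: eq_fsbigr => r; rewrite inE => -[z _ <-].
  under eq_integral do rewrite EFinM.
  have mS : measurable [set w | (g n @^-1` [set g n z]) (C w, U w)].
    by rewrite -[X in measurable X]setTI; exact: mCU.
  rewrite ge0_integralZl//.
  - by rewrite integral_indic// setIT.
  - by apply/measurable_EFinP; exact: measurable_indic.
transitivity (\sum_(r \in range (g n))
    (r%:E * \int[P]_w kappa (C w) (xsection (g n @^-1` [set r]) (C w)))).
  by apply: eq_fsbigr => r _; rewrite (dis (mE r)).2.
have mkx r : measurable_fun setT
    (fun w => kappa (C w) (xsection (g n @^-1` [set r]) (C w))).
  exact: (measurableT_comp (dis (mE r)).1 mC).
transitivity (\int[P]_w (\sum_(r \in range (g n))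
    (r%:E * kappa (C w) (xsection (g n @^-1` [set r]) (C w))))).
  rewrite ge0_integral_fsum//.
  - apply: eq_fsbigr => r; rewrite inE => -[z _ <-].
    by rewrite ge0_integralZl.
  - by move=> r; exact: measurable_funeM.
  - move=> r w _; have [r0|r0] := leP 0%R r; first exact: mule_ge0.
    rewrite preimage_nnfun0// xsection0 measure0 mule0//.
apply: eq_integral => w _.
under [RHS]eq_integral do rewrite gE.
rewrite ge0_integral_fsum//; last first.
  by move=> r; apply: (measurableT_comp (mI r)); exact: measurable_fun_pair.
apply: eq_fsbigr => r; rewrite inE => -[z _ <-].
under [RHS]eq_integral do rewrite EFinM.
have mx : measurable (xsection (g n @^-1` [set g n z]) (C w)).
  exact: measurable_xsection.
rewrite (eq_integral (fun u => (g n z)%:E *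
    (\1_(xsection (g n @^-1` [set g n z]) (C w)) u)%:E)) => [|u _].
  rewrite ge0_integralZl ?integral_indic ?setIT ?lee_fin//.
  by apply/measurable_EFinP; exact: measurable_indic.
by rewrite !indicE mem_xsection.
Qed.

End disintegrated_integral.

(** * Conditional independence and extra draws *)

Section conditional_independence.
Context d0 (Omega : measurableType d0) d1 (TC : measurableType d1)
  (R : realType) (P : probability Omega R) (C : Omega -> TC).
Hypothesis mC : measurable_fun setT C.
Local Open Scope ereal_scope.

Lemma integral_indic_bounds (E : set Omega) (B : set TC) :
  measurable E -> measurable B ->
  0 <= \int[P]_(w in C @^-1` B) (\1_E w)%:E < +oo.
Proof.
move=> mE mB; have mCB := measurable_preimageT mC mB.
rewrite integral_indic// measure_ge0/= (le_lt_trans (probability_le1 _ _)) ?ltry//.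
exact: measurableI.
Qed.

(** A version may take infinite or negative values on a null set; after this
    replacement it can serve as a weight in [integral_pull_out]. *)
Lemma version_nonneg_real (E : set Omega) (g : TC -> \bar R) :
  measurable E -> cond_prob_version P C E g ->
  exists gr : TC -> R, [/\ measurable_fun setT gr, forall c, (0 <= gr c)%R &
    {ae P, forall w, g (C w) = (gr (C w))%:E}].
Proof.
move=> mE [mg gE].
have gb B : measurable B -> 0 <= \int[P]_(w in C @^-1` B) g (C w) < +oo.
  by move=> mB; rewrite gE// integral_indic_bounds.
have intg := version_integrable mC mg gb.
have fing := integrable_ae measurableT intg.
have g0 : {ae P, forall w, cst 0 (C w) <= g (C w)}.
  apply: ae_le_version => //; first exact: integrable0.
  by move=> B mB; rewrite integral0; case/andP: (gb B mB).
exists (fun c => Num.max (fine (g c)) 0%R); split.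
- by apply: measurable_maxr => //; exact: measurableT_comp.
- by move=> c; rewrite le_max lexx orbT.
- apply: filterS2 fing g0 => w /(_ Logic.I) /= fing g0.
  by rewrite max_l ?fineK// fine_ge0.
Qed.

(** On a rectangle, P(U in A, V in B, C in D) is the integral over C in D of
    P(U in A | C) P(V in B | C); the second factor is replaced by the indicator
    of V in B because the first one is a function of C, and what remains is the
    integral of the law of U given C over V in B, C in D. *)
Lemma disintegrates_cond_indep d2 (TU : measurableType d2)
    d3 (TV : measurableType d3) (U : Omega -> TU) (V : Omega -> TV)
    (kappa : TC -> probability TU R) :
  measurable_fun setT U -> measurable_fun setT V ->
  disintegrates P C U kappa -> cond_indep P U V C ->
  disintegrates P (fun w => (C w, V w)) U (fun c => kappa c.1).
Proof.
move=> mU mV dis ci.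
have mCV : measurable_fun setT (fun w => (C w, V w)).
  exact: measurable_fun_pair.
apply: (disintegrates_pi mCV mU (pi_generator_prod (pi_generator_prod
  (pi_generator_measurable TC) (pi_generator_measurable TV))
  (pi_generator_measurable TU))).
move=> _ [_ [D mD [B mB <-]] [A mA <-]].
have mk := disintegrates_meas dis mA.
have xE c : kappa c.1 (xsection ((D `*` B) `*` A) c) =
    ((\1_D c.1)%:E * kappa c.1 A) * (\1_B c.2)%:E.
  rewrite !indicE; have [cD|cD] := boolP (c.1 \in D).
    have [cB|cB] := boolP (c.2 \in B).
      rewrite in_xsectionX ?mul1e ?mule1//.
      by move: cD cB; rewrite !inE => cD cB; split.
    rewrite mule0 notin_xsectionX ?measure0//.
    by apply: contra cB; rewrite !inE => -[].
  rewrite !mul0e notin_xsectionX ?measure0//.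
  by apply: contra cD; rewrite !inE => -[].
split.
  under eq_fun do rewrite xE.
  apply: emeasurable_funM; first apply: emeasurable_funM.
  - apply/measurable_EFinP; exact: measurableT_comp.
  - exact: (measurableT_comp mk measurable_fst).
  - apply/measurable_EFinP; exact: measurableT_comp.
have [f [g [vf vg [_ vfg]]]] := ci A B mA mB.
have mUA := measurable_preimageT mU mA.
have mVB := measurable_preimageT mV mB.
have mCD := measurable_preimageT mC mD.
have vk : cond_prob_version P C (U @^-1` A) (fun c => kappa c A).
  split=> // D' mD'; rewrite -(disintegrates_rect dis)// integral_indic//.
  exact: measurable_preimageT.
have fk : {ae P, forall w, f (C w) = kappa (C w) A}.
  apply: (ae_eq_version mC _ vf vk) => D' mD'.
  exact: integral_indic_bounds.
have [gr [mgr gr0 ggr]] := version_nonneg_real mVB vg.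
have mgrC : measurable_fun setT (fun w => gr (C w)) by exact: measurableT_comp.
pose psi c := (\1_D c)%:E * kappa c A.
have mpsi : measurable_fun setT psi.
  by apply: emeasurable_funM => //; apply/measurable_EFinP; exact: measurable_indic.
have mf : measurable_fun setT f by case: vf.
have mg : measurable_fun setT g by case: vg.
transitivity (\int[P]_w (psi (C w) * (gr (C w))%:E)).
  transitivity (\int[P]_(w in C @^-1` D) (f (C w) * g (C w))).
    rewrite vfg// integral_indic//; last exact: measurableI.
    by congr (P _); apply/seteqP; split=> w /= [[]]; tauto.
  rewrite integral_mkcond epatch_indic; apply: ae_eq_integral => //.
  - apply: emeasurable_funM; first by apply: emeasurable_funM; exact: measurableT_comp.
    apply/measurable_EFinP; exact: measurable_indic.
  - apply: emeasurable_funM; first exact: (measurableT_comp mpsi).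
    exact/measurable_EFinP.
  - apply: filterS2 fk ggr => w fkw ggw _ /=.
    by rewrite fkw ggw /psi muleC muleA.
rewrite (integral_pull_out mC (h1 := fun w => gr (C w)) (h2 := \1_(V @^-1` B)))//.
- by apply: eq_integral => w _; rewrite xE.
- by move=> c; rewrite mule_ge0// lee_fin.
- move=> D' mD'; have [_ vgD] := vg; rewrite -vgD//.
  have mCD' := measurable_preimageT mC mD'.
  apply: ae_eq_integral => //.
  - apply: measurable_funTS; exact/measurable_EFinP.
  - apply: measurable_funTS; exact: measurableT_comp.
  - by apply: filterS ggr => w ->.
Qed.

(** Here lam c stands for the law of a draw V made from C alone, as if V were
    independent of U given C; V is not a random variable on Omega. The joint law
    of U and such a draw given C is the product measure. *)
Lemma disintegrates_copy d2 (TU : measurableType d2)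
    d3 (TV : measurableType d3) (U : Omega -> TU)
    (kappa : TC -> probability TU R) (lam : TC -> probability TV R)
    (E : set (TC * (TU * TV))) :
  measurable_fun setT U -> disintegrates P C U kappa ->
  (forall A, measurable A -> measurable_fun setT (fun c => lam c A)) ->
  measurable E ->
  [/\ measurable_fun setT
        (fun z : TC * TU => lam z.1 (xsection (xsection E z.1) z.2)),
      measurable_fun setT (fun c => (kappa c \x lam c) (xsection E c)) &
      \int[P]_w lam (C w) (xsection (xsection E (C w)) (U w)) =
      \int[P]_w (kappa (C w) \x lam (C w)) (xsection E (C w))].
Proof.
move=> mU dis mlam mE.
pose phi (z : TC * TU) := lam z.1 (xsection (xsection E z.1) z.2).
have mphi : measurable_fun setT phi.
  pose E' : set (TC * TU * TV) := (fun t => (t.1.1, (t.1.2, t.2))) @^-1` E.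
  have mE' : measurable E'.
    apply: measurable_preimageT mE; apply: measurable_fun_pair.
      exact: (measurableT_comp measurable_fst).
    apply: measurable_fun_pair => //.
    exact: (measurableT_comp measurable_snd).
  have -> : phi = fun z => lam z.1 (xsection E' z).
    by apply/funext => z; rewrite /phi !xsectionE.
  apply: (measurable_kernel_xsection (kappa := fun z : TC * TU => lam z.1)) => //.
  by move=> A mA; exact: (measurableT_comp (mlam _ mA) measurable_fst).
split => //.
  have mk A : measurable A -> measurable_fun setT (fun c => kappa c A).
    exact: disintegrates_meas dis.
  by apply: (measurable_kernel_integral mk (f := phi)).
by rewrite (disintegrates_integral mC mU dis (f := phi)).
Qed.

End conditional_independence.

(** * Conditional law of an i.i.d. sample *)

Section independent_families.
Context d0 (Omega : measurableType d0) (R : realType) (P : probability Omega R).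
Local Open Scope ereal_scope.

Lemma measurable_rvtuple d1 (T : measurableType d1) n (V : 'I_n -> Omega -> T) :
  (forall i, measurable_fun setT (V i)) -> measurable_fun setT (rvtuple V).
Proof.
move=> mV; apply/measurable_fun_tnthP => i.
rewrite (_ : _ \o _ = V i)//; apply/funext => w /=; exact: tnth_mktuple.
Qed.

(** Independence says that the law of the tuple is a product probability, and
    boxes determine that law. *)
Lemma mutual_indep_integral d1 (T : measurableType d1) n
    (V : 'I_n -> Omega -> T) (f : 'I_n -> T -> \bar R) :
  (forall i, measurable_fun setT (V i)) -> mutual_indep P V ->
  (forall i, measurable_fun setT (f i)) -> (forall i x, 0 <= f i x) ->
  \int[P]_w (\prod_(i < n) f i (V i w)) = \prod_(i < n) \int[P]_w f i (V i w).
Proof.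
move=> mV indV mf f0.
pose V' i : {mfun Omega >-> T} :=
  HB.pack (V i) (isMeasurableFun.Build _ _ _ _ (V i) (mV i)).
have mVs := measurable_rvtuple mV.
pose Vs : {mfun Omega >-> n.-tuple T} :=
  HB.pack (rvtuple V) (isMeasurableFun.Build _ _ _ _ (rvtuple V) mVs).
have lawV : forall A, measurable A ->
    distribution P Vs A = prod_prob (fun i => distribution P (V' i)) A.
  apply: (pi_generator_unique (pi_generator_box T n)).
    exact: (le_lt_trans (probability_le1 (distribution P Vs) measurableT) (ltry 1)).
  move=> _ [A mA <-].
  transitivity (\prod_(i < n) distribution P (V' i) (A i)); last first.
    exact/esym/prod_prob_box.
  rewrite -indV//; congr (P _).
  by apply/seteqP; split=> w h i; have := h i; rewrite tnth_mktuple.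
have mprod : measurable_fun setT
    (fun t : n.-tuple T => \prod_(i < n) f i (tnth t i)).
  apply: emeasurable_prod => i.
  by apply: measurableT_comp => //; exact: measurable_tnth.
transitivity (\int[distribution P Vs]_t (\prod_(i < n) f i (tnth t i))).
  rewrite ge0_integral_distribution//; last by move=> t; exact: prode_ge0.
  apply: eq_integral => w _ /=; apply: eq_bigr => i _.
  by rewrite tnth_mktuple.
rewrite (eq_measure_integral (prod_prob (fun i => distribution P (V' i)))).
  rewrite integral_prod_prob//; apply: eq_bigr => i _.
  by rewrite ge0_integral_distribution.
by move=> A mA _; exact: lawV.
Qed.

(** On boxes the claim is a product over i: the coordinates are independent,
    and each factor is the conditional law of one coordinate. *)
Lemma disintegrates_iid d1 (TV : measurableType d1) d2 (TU : measurableType d2)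
    n (V : 'I_n -> Omega -> TV) (U : 'I_n -> Omega -> TU)
    (kappa : TV -> probability TU R) :
  (forall i, measurable_fun setT (V i)) ->
  (forall i, measurable_fun setT (U i)) ->
  mutual_indep P (fun i w => (V i w, U i w)) ->
  (forall i, disintegrates P (V i) (U i) kappa) ->
  (forall A, measurable A -> measurable_fun setT (fun c => kappa c A)) ->
  disintegrates P (rvtuple V) (rvtuple U)
    (fun v => prod_prob (fun i => kappa (tnth v i))).
Proof.
move=> mV mU ind dis mk.
apply: (disintegrates_pi (measurable_rvtuple mV) (measurable_rvtuple mU)
  (pi_generator_prod (pi_generator_box _ n) (pi_generator_box _ n))).
move=> _ [_ [B mB <-] [_ [A mA <-] <-]].
pose g i v := (\1_(B i) v)%:E * kappa v (A i).
have mg i : measurable_fun setT (g i).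
  apply: emeasurable_funM; last exact: mk.
  by apply/measurable_EFinP; exact: measurable_indic.
have g0 i v : 0 <= g i v by rewrite mule_ge0// lee_fin.
have xE v : prod_prob (fun i => kappa (tnth v i)) (xsection (box B `*` box A) v) =
            \prod_(i < n) g i (tnth v i).
  have [vB|vB] := boolP (v \in box B).
    rewrite in_xsectionX// prod_prob_box//; apply: eq_bigr => i _.
    by rewrite /g indicE mem_set ?mul1e//; move: vB; rewrite inE.
  rewrite notin_xsectionX// measure0.
  have [i Bi] : exists i, ~ B i (tnth v i).
    apply: contrapT => /forallNP h; move/negP : vB; apply.
    by rewrite inE => i; exact: contrapT.
  by rewrite (bigD1 i)//= /g indicE memNset// mul0e mul0e.
split.
  under eq_fun do rewrite xE; apply: emeasurable_prod => i.
  by apply: measurableT_comp => //; exact: measurable_tnth.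
have indV : mutual_indep P V.
  move=> B' mB'; have := ind (fun i => B' i `*` setT).
  rewrite (_ : [set w | _] = [set w | forall i, B' i (V i w)]); last first.
    by apply/seteqP; split=> w h i; [have [] := h i|split => //; exact: h].
  move=> -> //; last by move=> i; exact: measurableX.
  by apply: eq_bigr => i _; congr (P _); apply/seteqP; split=> w; [case|].
transitivity (P [set w | forall i, (B i `*` A i) (V i w, U i w)]).
  congr (P _); apply/seteqP; split=> w /=.
    move=> [/= HB HA] i; have := HB i; have := HA i.
    by rewrite !tnth_mktuple.
  by move=> h; split=> i /=; rewrite tnth_mktuple; have [] := h i.
rewrite (ind (fun i => B i `*` A i)) => [|i]; last exact: measurableX.
transitivity (\prod_(i < n) \int[P]_w g i (V i w)).
  apply: eq_bigr => i _; rewrite ((dis i) _ (measurableX (mB i) (mA i))).2.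
  apply: eq_integral => w _; rewrite /g indicE.
  have [vB|vB] := boolP (V i w \in B i).
    by rewrite in_xsectionX// mul1e.
  by rewrite notin_xsectionX// measure0 mul0e.
rewrite -mutual_indep_integral//; apply: eq_integral => w _.
by rewrite xE; apply: eq_bigr => i _; rewrite tnth_mktuple.
Qed.

Lemma same_law_integral d1 (T : measurableType d1) (V V' : Omega -> T)
    (f : T -> \bar R) :
  measurable_fun setT V -> measurable_fun setT V' -> same_law P V V' ->
  measurable_fun setT f -> (forall x, 0 <= f x) ->
  \int[P]_w f (V w) = \int[P]_w f (V' w).
Proof.
move=> mV mV' VV' mf f0.
pose mfV : {mfun Omega >-> T} := HB.pack V (isMeasurableFun.Build _ _ _ _ V mV).
pose mfV' : {mfun Omega >-> T} :=
  HB.pack V' (isMeasurableFun.Build _ _ _ _ V' mV').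
transitivity (\int[distribution P mfV]_t f t).
  by rewrite ge0_integral_distribution.
rewrite (eq_measure_integral (distribution P mfV')).
  by rewrite ge0_integral_distribution.
by move=> A mA _; exact: VV'.
Qed.

Lemma disintegrates_same_law d1 (TC : measurableType d1)
    d2 (TU : measurableType d2) (C C' : Omega -> TC) (U U' : Omega -> TU)
    (kappa : TC -> probability TU R) :
  measurable_fun setT C -> measurable_fun setT C' ->
  same_law P (fun w => (C' w, U' w)) (fun w => (C w, U w)) ->
  disintegrates P C U kappa -> disintegrates P C' U' kappa.
Proof.
move=> mC mC' CU dis E mE; have [mk PE] := dis E mE; split=> //.
transitivity (P [set w | E (C w, U w)]); first exact: CU.
rewrite PE; apply: (same_law_integral (f := fun c => kappa c (xsection E c))) => //.
move=> B mB; have := CU (B `*` setT) (measurableX mB measurableT).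
rewrite (_ : _ @^-1` _ = C' @^-1` B); last by apply/seteqP; split=> w; [case|].
rewrite (_ : (fun w => (C w, U w)) @^-1` _ = C @^-1` B) => [->//|].
by apply/seteqP; split=> w; [case|].
Qed.

(** The right inverse phi transports measurability of the sections back to
    the new conditioning space. *)
Lemma disintegrates_map d1 (TC : measurableType d1) d2 (TU : measurableType d2)
    d3 (TV : measurableType d3) (V : Omega -> TV) (U : Omega -> TU)
    (kappa : TC -> probability TU R) (psi : TV -> TC) (phi : TC -> TV) :
  measurable_fun setT psi -> measurable_fun setT phi -> cancel phi psi ->
  disintegrates P V U (kappa \o psi) -> disintegrates P (psi \o V) U kappa.
Proof.
move=> mpsi mphi phiK dis E mE.
pose E' : set (TV * TU) := (fun z => (psi z.1, z.2)) @^-1` E.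
have mE' : measurable E'.
  apply: measurable_preimageT mE; apply: measurable_fun_pair => //.
  exact: (measurableT_comp mpsi).
have [mk PE] := dis E' mE'.
have xE v : xsection E' v = xsection E (psi v) by rewrite !xsectionE.
split; last by rewrite [LHS]PE; apply: eq_integral => w _; rewrite xE.
have -> : (fun c => kappa c (xsection E c)) =
          (fun v => (kappa \o psi) v (xsection E' v)) \o phi.
  by apply/funext => c /=; rewrite xE phiK.
exact: measurableT_comp.
Qed.

End independent_families.

(** * Ranks and swaps *)

Section ranks.
Variables (R : realType) (S : finType) (t : S -> R) (N : nat).

Definition upper_rank (u : N.-tuple S) (i : 'I_N) : nat :=
  (\sum_(j < N) (t (tnth u i) <= t (tnth u j))%R)%N.

(** Among the indices of upper rank at most k take one where t is smallest:
    all the others are counted in its upper rank. *)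
Lemma card_upper_rank_le (u : N.-tuple S) (k : nat) :
  (\sum_(i < N) (upper_rank u i <= k) <= k)%N.
Proof.
have [i0 i0k|noi] := pickP (fun i => upper_rank u i <= k)%N; last first.
  by rewrite big1// => i _; rewrite noi.
case: (@arg_minP _ R _ i0 [pred i | (upper_rank u i <= k)%N]
  (fun i => t (tnth u i)) i0k) => i ik imin.
apply: leq_trans ik; apply: leq_sum => j _.
by have [jk|//] := boolP (upper_rank u j <= k)%N; rewrite imin.
Qed.

Definition perm_tuple (s : {perm 'I_N}) (u : N.-tuple S) : N.-tuple S :=
  [tuple tnth u (s i) | i < N].

Lemma perm_tuple_bij s : bijective (perm_tuple s).
Proof.
exists (perm_tuple s^-1%g) => u; apply: eq_from_tnth => i;
by rewrite !tnth_mktuple ?permK ?permKV.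
Qed.

Lemma upper_rank_perm s u i :
  upper_rank (perm_tuple s u) i = upper_rank u (s i).
Proof.
rewrite /upper_rank [RHS](reindex_inj (@perm_inj _ s)).
by apply: eq_bigr => j _; rewrite !tnth_mktuple.
Qed.

(** Permuting the entries shows that the count of tuples is the same for every
    index i0, so N times it is a sum over tuples and indices at once. *)
Lemma upper_rank_exchangeable (i0 : 'I_N) (k : nat) :
  (N * \sum_(u : N.-tuple S) (upper_rank u i0 <= k) <= k * #|S| ^ N)%N.
Proof.
have -> : (N * \sum_(u : N.-tuple S) (upper_rank u i0 <= k) =
    \sum_(u : N.-tuple S) \sum_(i < N) (upper_rank u i <= k))%N.
  have constE m : (N * m = \sum_(i < N) m)%N by rewrite sum_nat_const card_ord.
  rewrite exchange_big/= constE.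
  apply: eq_bigr => i _.
  rewrite (reindex (perm_tuple (tperm i0 i))); last first.
    by apply: onW_bij; exact: perm_tuple_bij.
  by apply: eq_bigr => u _; rewrite upper_rank_perm tpermL.
rewrite -card_tuple mulnC -sum_nat_const.
by apply: leq_sum => u _; exact: card_upper_rank_le.
Qed.

End ranks.

Lemma sum_tuple_cons (V : nmodType) (S : finType) (B : nat)
    (F : B.+1.-tuple S -> V) :
  \sum_(u : B.+1.-tuple S) F u =
  \sum_(s : S) \sum_(ss : B.-tuple S) F [tuple of s :: ss].
Proof.
rewrite pair_big/= (reindex (fun p : S * B.-tuple S => [tuple of p.1 :: p.2])) //=.
exists (fun u : B.+1.-tuple S => (thead u, [tuple of behead u])) => [[s ss]|u] _ /=.
  by rewrite theadE; congr (_, _); exact: val_inj.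
by rewrite -tuple_eta.
Qed.

Section swaps.
Context d (T : measurableType d) (R : realType) (n : nat).
Implicit Types s : n.-tuple bool.

Definition swap_tuples s (p : n.-tuple T * n.-tuple T) :=
  ([tuple if tnth s i then tnth p.1 i else tnth p.2 i | i < n],
   [tuple if tnth s i then tnth p.2 i else tnth p.1 i | i < n]).

Lemma measurable_swap_tuples s : measurable_fun setT (swap_tuples s).
Proof.
have mt1 i : measurable_fun setT (fun p : n.-tuple T * n.-tuple T => tnth p.1 i).
  by apply: (measurableT_comp (measurable_tnth i)).
have mt2 i : measurable_fun setT (fun p : n.-tuple T * n.-tuple T => tnth p.2 i).
  by apply: (measurableT_comp (measurable_tnth i)).
apply: measurable_fun_pair; apply/measurable_fun_tnthP => i.
  rewrite (_ : _ \o _ = fun p => if tnth s i then tnth p.1 i else tnth p.2 i).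
    by case: (tnth s i).
  by apply/funext => p /=; rewrite tnth_mktuple.
rewrite (_ : _ \o _ = fun p => if tnth s i then tnth p.2 i else tnth p.1 i).
  by case: (tnth s i).
by apply/funext => p /=; rewrite tnth_mktuple.
Qed.

(** The two entries in position i have the same law m i, so exchanging them
    does not change the mass of a product of two boxes. *)
Lemma swap_tuples_invariant (m : 'I_n -> probability T R) s
    (E : set (n.-tuple T * n.-tuple T)) : measurable E ->
  ((prod_prob m \x prod_prob m) (swap_tuples s @^-1` E) =
   (prod_prob m \x prod_prob m) E)%E.
Proof.
move=> mE; set M := prod_prob m.
pose swp : {mfun (n.-tuple T * n.-tuple T)%type >-> (n.-tuple T * n.-tuple T)%type} :=
  HB.pack (swap_tuples s)
    (isMeasurableFun.Build _ _ _ _ (swap_tuples s) (measurable_swap_tuples s)).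
apply: (@pi_generator_unique _ _ _ _ (distribution (M \x M)%E swp) (M \x M)%E
  (pi_generator_prod (pi_generator_box T n) (pi_generator_box T n))) => //.
  exact: (le_lt_trans (probability_le1 (distribution _ swp) measurableT) (ltry 1)).
move=> _ [_ [A mA <-] [_ [A' mA' <-] <-]].
rewrite /distribution/= /pushforward.
have -> : swap_tuples s @^-1` (box A `*` box A') =
    box (fun i => if tnth s i then A i else A' i) `*`
    box (fun i => if tnth s i then A' i else A i).
  apply/seteqP; split=> -[x x1] /=.
    move=> [/= h h']; split=> i /=; move: (h i) (h' i); rewrite !tnth_mktuple;
    by case: ifP.
  move=> [/= h h']; split=> i /=; move: (h i) (h' i); rewrite !tnth_mktuple;
  by case: ifP.
have mif (F F' : 'I_n -> set T) : (forall i, measurable (F i)) ->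
    (forall i, measurable (F' i)) ->
    forall i, measurable (if tnth s i then F i else F' i).
  by move=> mF mF' i; case: ifP.
rewrite !product_measure1E; do ?by apply: measurable_box => //; exact: mif.
transitivity (((\prod_(i < n) m i (if tnth s i then A i else A' i)) *
               (\prod_(i < n) m i (if tnth s i then A' i else A i)))%E).
  by congr (_ * _)%E; apply: prod_prob_box; exact: mif.
transitivity (((\prod_(i < n) m i (A i)) * (\prod_(i < n) m i (A' i)))%E);
  last by congr (_ * _)%E; apply/esym/prod_prob_box.
rewrite -!big_split/=; apply: eq_bigr => i _.
by case: ifP => // _; rewrite muleC.
Qed.

End swaps.

(** * The statistic and its p-value *)

Section measurability_of_the_statistic.
Context d0 (Omega : measurableType d0) (R : realType).

Lemma measurable_cat_tuple d (T : measurableType d) n1 n2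
    (f : Omega -> n1.-tuple T) (g : Omega -> n2.-tuple T) :
  measurable_fun setT f -> measurable_fun setT g ->
  measurable_fun setT (fun w => cat_tuple (f w) (g w)).
Proof.
move=> mf mg; apply/measurable_fun_tnthP => i; have [j ->|j ->] := split_ordP i.
  rewrite (_ : _ \o _ = fun w => tnth (f w) j).
    exact: (measurableT_comp (measurable_tnth j) mf).
  by apply/funext => w /=; rewrite tnth_lshift.
rewrite (_ : _ \o _ = fun w => tnth (g w) j).
  exact: (measurableT_comp (measurable_tnth j) mg).
by apply/funext => w /=; rewrite tnth_rshift.
Qed.

Lemma measurable_gauss_kernel (sigma : R) d (f g : Omega -> d.-tuple R) :
  measurable_fun setT f -> measurable_fun setT g ->
  measurable_fun setT (fun w => gauss_kernel sigma (f w) (g w)).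
Proof.
move=> mf mg; apply: measurableT_comp; first exact: measurable_expR.
apply: measurable_funN; apply: measurable_funM => //.
apply: measurable_funM => //; apply: measurable_sum => k.
apply: measurable_funX; apply: measurable_funB.
  exact: (measurableT_comp (measurable_tnth k) mf).
exact: (measurableT_comp (measurable_tnth k) mg).
Qed.

Context (n dX dY dZ : nat).
Variables (X X1 : 'I_n -> Omega -> dX.-tuple R) (Y : 'I_n -> Omega -> dY.-tuple R)
  (Z : 'I_n -> Omega -> dZ.-tuple R) (sigma : R).
Hypotheses (mX : forall i, measurable_fun setT (X i))
  (mX1 : forall i, measurable_fun setT (X1 i))
  (mY : forall i, measurable_fun setT (Y i))
  (mZ : forall i, measurable_fun setT (Z i)).

Lemma measurable_zeta_hat :
  measurable_fun setT
    (fun w => zeta_hat sigma (X ^~ w) (X1 ^~ w) (Y ^~ w) (Z ^~ w)).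
Proof.
have mK (f g : 'I_n -> Omega -> dX.-tuple R) i j :
    (forall i, measurable_fun setT (f i)) ->
    (forall i, measurable_fun setT (g i)) -> measurable_fun setT
      (fun w => gauss_kernel sigma
        (cat_tuple (cat_tuple (f i w) (Y i w)) (Z i w))
        (cat_tuple (cat_tuple (g j w) (Y j w)) (Z j w))).
  by move=> mf mg; apply: measurable_gauss_kernel;
    do ?[exact: measurable_cat_tuple|apply: measurable_cat_tuple].
apply: measurable_funM => //; apply: measurable_sum => i.
under eq_fun do rewrite big_mkcond/=; apply: measurable_sum => j.
case: (i < j)%N => //; apply: measurable_funB; last exact: mK.
apply: measurable_funB; last exact: mK.
by apply: measurable_funD; exact: mK.
Qed.

End measurability_of_the_statistic.

Section measurability_of_the_pvalue.
Context d0 (Omega : measurableType d0) (R : realType) (n dX dY dZ : nat).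
Variables (X X1 : 'I_n -> Omega -> dX.-tuple R) (Y : 'I_n -> Omega -> dY.-tuple R)
  (Z : 'I_n -> Omega -> dZ.-tuple R) (sigma : R).
Hypotheses (mX : forall i, measurable_fun setT (X i))
  (mX1 : forall i, measurable_fun setT (X1 i))
  (mY : forall i, measurable_fun setT (Y i))
  (mZ : forall i, measurable_fun setT (Z i)).

Lemma measurable_pvalue B (s : 'I_B -> n.-tuple bool) :
  measurable_fun setT
    (fun w => pvalue sigma (X ^~ w) (X1 ^~ w) (Y ^~ w) (Z ^~ w) s).
Proof.
have mzs (b : 'I_B) : measurable_fun setT
    (fun w => zeta_hat_swap sigma (X ^~ w) (X1 ^~ w) (Y ^~ w) (Z ^~ w) (s b)).
  apply: (measurable_zeta_hat
    (X := fun i w => if tnth (s b) i then X i w else X1 i w)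
    (X1 := fun i w => if tnth (s b) i then X1 i w else X i w)) => // i;
  by case: (tnth (s b) i).
apply: measurable_funM => //; apply: measurable_funD => //.
apply: measurable_sum => b.
apply: (measurableT_comp (f := fun c : bool => c%:R : R)) => //.
by apply: measurable_fun_ler => //; exact: measurable_zeta_hat.
Qed.

End measurability_of_the_pvalue.

Section rank_of_the_statistic.
Context (R : realType) (n dX dY dZ B : nat) (sigma alpha : R).
Variables (Y : 'I_n -> dY.-tuple R) (Z : 'I_n -> dZ.-tuple R).
Hypothesis alpha0 : 0 <= alpha.
Implicit Types s : n.-tuple bool.

Definition bits_eq s s' : n.-tuple bool := [tuple tnth s' i == tnth s i | i < n].

Lemma bits_eqK s : involutive (bits_eq s).
Proof.
move=> s'; apply: eq_from_tnth => i; rewrite !tnth_mktuple.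
by case: (tnth s i); case: (tnth s' i).
Qed.

Definition swapped_stat (p : n.-tuple (dX.-tuple R) * n.-tuple (dX.-tuple R)) s :=
  zeta_hat_swap sigma (tnth p.1) (tnth p.2) Y Z s.

(** Swapping by s and then by s' leaves in place the positions where the two
    bits agree. *)
Lemma zeta_hat_swap_swap p s s' :
  swapped_stat (swap_tuples s p) s' = swapped_stat p (bits_eq s s').
Proof.
rewrite /swapped_stat /zeta_hat_swap.
have -> : (fun i => if tnth s' i then tnth (swap_tuples s p).1 i
                    else tnth (swap_tuples s p).2 i) =
          (fun i => if tnth (bits_eq s s') i then tnth p.1 i else tnth p.2 i).
  apply/funext => i; rewrite !tnth_mktuple.
  by case: (tnth s i); case: (tnth s' i).
have -> // : (fun i => if tnth s' i then tnth (swap_tuples s p).2 i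
                       else tnth (swap_tuples s p).1 i) =
             (fun i => if tnth (bits_eq s s') i then tnth p.2 i else tnth p.1 i).
apply/funext => i; rewrite !tnth_mktuple.
by case: (tnth s i); case: (tnth s' i).
Qed.

Lemma zeta_hat_swap_tuples p s :
  zeta_hat sigma (tnth (swap_tuples s p).1) (tnth (swap_tuples s p).2) Y Z =
  swapped_stat p s.
Proof.
rewrite /swapped_stat /zeta_hat_swap.
have -> : tnth (swap_tuples s p).1 = (fun i => if tnth s i then tnth p.1 i else tnth p.2 i).
  by apply/funext => i; rewrite tnth_mktuple.
have -> // : tnth (swap_tuples s p).2 = (fun i => if tnth s i then tnth p.2 i else tnth p.1 i).
by apply/funext => i; rewrite tnth_mktuple.
Qed.

(** The term added to the sum in the p-value is the comparison of the observed
    statistic with itself, so the p-value is a normalised upper rank. *)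
Lemma pvalue_le_rank p s (ss : B.-tuple (n.-tuple bool)) :
  (pvalue sigma (tnth (swap_tuples s p).1) (tnth (swap_tuples s p).2) Y Z
     (tnth ss) <= alpha) =
  (upper_rank (swapped_stat p) [tuple of s :: map_tuple (bits_eq s) ss] ord0
     <= `|Num.floor (B.+1%:R * alpha)|)%N.
Proof.
set u := [tuple of s :: _].
have -> : pvalue sigma (tnth (swap_tuples s p).1) (tnth (swap_tuples s p).2) Y Z
    (tnth ss) = B.+1%:R^-1 * (upper_rank (swapped_stat p) u ord0)%:R.
  rewrite /pvalue /upper_rank big_ord_recl lexx addnC natrD; congr (_ * (_ + _)).
  rewrite natr_sum; apply: eq_bigr => b _.
  rewrite zeta_hat_swap_tuples -/(swapped_stat (swap_tuples s p) (tnth ss b)).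
  by rewrite zeta_hat_swap_swap tnth0 tnthS tnth_map.
rewrite ler_pdivrMl ?ltr0n// -[X in (X <= _)]/((upper_rank _ _ _)%:Z%:~R).
rewrite -floor_ge_int -lez_nat gez0_abs//.
by rewrite floor_ge0 mulr_ge0.
Qed.

Let k := `|Num.floor (B.+1%:R * alpha)|%N.

Lemma sum_pvalue_le (p : n.-tuple (dX.-tuple R) * n.-tuple (dX.-tuple R)) :
  (B.+1 * (\sum_(s : n.-tuple bool) \sum_(ss : B.-tuple (n.-tuple bool))
    (pvalue sigma (tnth (swap_tuples s p).1) (tnth (swap_tuples s p).2) Y Z
       (tnth ss) <= alpha)%R) <= k * (2 ^ n) ^ B.+1)%N.
Proof.
rewrite -card_bool -card_tuple.
apply: leq_trans (upper_rank_exchangeable (swapped_stat p) (ord0 : 'I_B.+1) k).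
rewrite leq_mul2l/= sum_tuple_cons; apply: eq_leq; apply: eq_bigr => s _.
rewrite [RHS](reindex_inj (h := map_tuple (bits_eq s))) /=.
  by apply: eq_bigr => ss _; rewrite pvalue_le_rank.
move=> ss ss' /(congr1 val)/= /inj_map eqss; apply/val_inj/eqss.
exact: inv_inj (bits_eqK s).
Qed.

End rank_of_the_statistic.

(** * Total variation and random seeds *)

Section images.
Context d0 (Omega : measurableType d0) (R : realType) (P : probability Omega R).
Context d1 (T1 : measurableType d1) d2 (T2 : measurableType d2) (g : T1 -> T2).
Hypothesis mg : measurable_fun setT g.

Lemma mutual_indep_comp (I : finType) (U : I -> Omega -> T1) :
  mutual_indep P U -> mutual_indep P (fun i => g \o U i).
Proof.
move=> indU A mA; apply: (indU (fun i => g @^-1` A i)) => i.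
exact: measurable_preimageT.
Qed.

Lemma same_law_comp (U V : Omega -> T1) :
  same_law P U V -> same_law P (g \o U) (g \o V).
Proof. by move=> UV A mA; apply: (UV (g @^-1` A)); exact: measurable_preimageT. Qed.

End images.

Section inner_integral.
Context d (T : measurableType d) (R : realType) (mu : {measure set T -> \bar R}).
Local Open Scope ereal_scope.
Import HBNNSimple.

(** The integral of a nonnegative function is a supremum over the simple
    functions below it. The total variation distance, a supremum over all
    measurable sets, is integrated in this sense. *)
Lemma ge0_le_integral_inner (D : set T) (f g : T -> \bar R) :
  (forall x, 0 <= f x) -> (forall x, f x <= g x) ->
  \int[mu]_(x in D) f x <= \int[mu]_(x in D) g x.
Proof.
move=> f0 fg; have g0 x : 0 <= g x by exact: le_trans (f0 x) (fg x).
rewrite !(integral_mkcond D) !ge0_integralTE; last 2 first.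
- by move=> x; exact: erestrict_ge0.
- by move=> x; exact: erestrict_ge0.
apply: ge_ereal_sup => _ [h hf <-]; apply: ereal_sup_ubound; exists h => // x.
by apply: le_trans (hf x) _; apply: lee_restrict.
Qed.

End inner_integral.

Section total_variation.
Context d (T : measurableType d) (R : realType) (m1 m2 : probability T R).
Local Open Scope ereal_scope.

Lemma dTV_ge0 : 0 <= dTV m1 m2.
Proof.
apply: ereal_sup_ubound; exists set0; first exact: measurable0.
by rewrite (measure0 m1) (measure0 m2) subee// abse0.
Qed.

Lemma dTV_le1 : dTV m1 m2 <= 1.
Proof.
have dist_le1 (a b : \bar R) : 0 <= a -> a <= 1 -> 0 <= b -> b <= 1 ->
    `|a - b| <= 1.
  move: a b => [a| |] [b| |] //; rewrite -?EFinB ?abse_EFin !lee_fin => *.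
  by rewrite ler_norml; apply/andP; split; lra.
apply: ge_ereal_sup => _ [A mA <-].
by apply: dist_le1; [exact: measure_ge0|exact: probability_le1|
                     exact: measure_ge0|exact: probability_le1].
Qed.

Lemma le_dTV (A : set T) : measurable A -> m1 A <= m2 A + dTV m1 m2.
Proof.
move=> mA; rewrite -(leeBlDl _ _ (fin_num_measure m2 A mA)).
apply: le_trans (lee_abs _) _; apply: ereal_sup_ubound.
by exists A.
Qed.

End total_variation.

Section product_bound.
Context d1 (T1 : measurableType d1) d2 (T2 : measurableType d2) (R : realType).
Variables (m : probability T1 R) (m1 m2 : probability T2 R).
Local Open Scope ereal_scope.

Lemma product_le_dTV (A : set (T1 * T2)) : measurable A ->
  (m \x m1) A <= (m \x m2) A + dTV m1 m2.
Proof.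
move=> mA; rewrite /product_measure1.
have -> : dTV m1 m2 = \int[m]_x (cst (dTV m1 m2) x).
  by rewrite integral_cst//= probability_setT mule1.
have mx (m' : probability T2 R) : measurable_fun setT (m' \o xsection A).
  exact: measurable_fun_xsection.
rewrite -ge0_integralD//; last by move=> x _; exact: dTV_ge0.
apply: ge0_le_integral => //; first exact: emeasurable_funD.
by move=> x _ /=; apply: le_dTV; exact: measurable_xsection.
Qed.

End product_bound.

Section randomization.
Context d0 (Omega : measurableType d0) (R : realType) (P : probability Omega R).
Local Open Scope ereal_scope.

Lemma measurable_tuple1 d (T : measurableType d) n (s : n.-tuple T) :
  (forall x : T, measurable [set x]) -> measurable [set s].
Proof.
move=> m1; rewrite (_ : [set s] = box (fun i => [set tnth s i])).
  exact: measurable_box.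
apply/seteqP; split=> [t -> //|t st]; apply: eq_from_tnth => i; exact: st.
Qed.

Lemma measurable_bits1 n B (ss : B.-tuple (n.-tuple bool)) : measurable [set ss].
Proof. by apply: measurable_tuple1 => s; exact: measurable_tuple1. Qed.

Section random_selection.
Context (n B : nat) d (TV : measurableType d).
Variables (pi : 'I_B -> Omega -> n.-tuple bool) (V : Omega -> TV)
  (G : B.-tuple (n.-tuple bool) -> set TV).
Hypotheses (mpi : forall b, measurable_fun setT (pi b))
  (mV : measurable_fun setT V) (mG : forall ss, measurable (G ss)).

Let mE ss : measurable (rvtuple pi @^-1` [set ss] `&` V @^-1` G ss).
Proof.
apply: measurableI; last exact: measurable_preimageT.
apply: measurable_preimageT; last exact: measurable_bits1.
exact: measurable_rvtuple.
Qed.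

Lemma measurable_random_selection :
  measurable [set w | G (rvtuple pi w) (V w)].
Proof.
rewrite (_ : [set w | _] = \big[setU/set0]_ss
    (rvtuple pi @^-1` [set ss] `&` V @^-1` G ss)).
  exact: bigsetU_measurable.
rewrite -bigcup_seq; apply/seteqP; split=> [w /= Gw|w [ss _ [/= <-]]//].
by exists (rvtuple pi w) => //=; rewrite mem_index_enum.
Qed.

(** Split according to the value of the seeds. *)
Lemma probability_random_selection :
  mutual_indep P pi -> (forall b, uniform_bits P (pi b)) ->
  indep P (rvtuple pi) V ->
  P [set w | G (rvtuple pi w) (V w)] =
  \sum_(ss : B.-tuple (n.-tuple bool))
     (((2 ^+ n)^-1 ^+ B)%R)%:E * P (V @^-1` G ss).
Proof.
move=> ind unif indV.
have indE w : \1_[set w | G (rvtuple pi w) (V w)] w =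
    (\sum_(ss : B.-tuple (n.-tuple bool))
      \1_(rvtuple pi @^-1` [set ss] `&` V @^-1` G ss) w)%R :> R.
  rewrite (bigD1 (rvtuple pi w))//= big1 => [|ss ss_w]; last first.
    by rewrite indicE memNset// => -[/= ssE _]; rewrite ssE eqxx in ss_w.
  rewrite addr0 !indicE; congr ((nat_of_bool _)%:R).
  by apply/idP/idP; rewrite !inE//= => -[].
have -> : P [set w | G (rvtuple pi w) (V w)] =
    \sum_ss P (rvtuple pi @^-1` [set ss] `&` V @^-1` G ss).
  rewrite -[X in P X](setIT [set w | G (rvtuple pi w) (V w)]).
  rewrite -integral_indic//; last exact: measurable_random_selection.
  under eq_integral do rewrite indE -sumEFin.
  rewrite ge0_integral_sum//; last first.
    by move=> ss; apply/measurable_EFinP; exact: measurable_indic.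
  by apply: eq_bigr => ss _; rewrite integral_indic// setIT.
apply: eq_bigr => ss _.
rewrite indV//; last exact: measurable_bits1.
congr (_ * _).
have -> : rvtuple pi @^-1` [set ss] =
          [set w | forall b, [set tnth ss b] (pi b w)].
  apply/seteqP; split=> w /=; first by move=> <- b; rewrite tnth_mktuple.
  by move=> h; apply: eq_from_tnth => b; rewrite tnth_mktuple h.
rewrite (ind (fun b => [set tnth ss b])) => [|b]; last by apply: measurable_tuple1.
under eq_bigr do rewrite unif.
by rewrite prodEFin prodr_const card_ord.
Qed.

End random_selection.

End randomization.

(** * The level under the true conditional law *)

Section copies.
Context d0 (Omega : measurableType d0) d1 (TC : measurableType d1)
  (R : realType) (P : probability Omega R) (C : Omega -> TC).
Hypothesis mC : measurable_fun setT C.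
Local Open Scope ereal_scope.

Lemma disintegrates_copy_on d2 (TU : measurableType d2)
    d3 (TV : measurableType d3) (U : Omega -> TU)
    (kappa : TC -> probability TU R) (lam : TC -> probability TV R)
    (E : set (TC * (TU * TV))) (D : set TC) :
  measurable_fun setT U -> disintegrates P C U kappa ->
  (forall A, measurable A -> measurable_fun setT (fun c => lam c A)) ->
  measurable E -> measurable D ->
  \int[P]_(w in C @^-1` D) lam (C w) (xsection (xsection E (C w)) (U w)) =
  \int[P]_(w in C @^-1` D) (kappa (C w) \x lam (C w)) (xsection E (C w)).
Proof.
move=> mU dis mlam mE mD; pose E' := E `&` (D `*` setT).
have mE' : measurable E' by apply: measurableI => //; exact: measurableX.
have [_ _ /esym copyE] := disintegrates_copy mC mU dis mlam mE'.
have xE c : xsection E' c = if c \in D then xsection E c else set0.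
  rewrite xsectionI; case: ifPn => cD; first by rewrite in_xsectionX// setIT.
  by rewrite notin_xsectionX// setI0.
rewrite [LHS]integral_mkcond [RHS]integral_mkcond !epatch_indic.
transitivity (\int[P]_w lam (C w) (xsection (xsection E' (C w)) (U w))).
  apply: eq_integral => w _; rewrite /= xE indicE.
  rewrite (_ : (w \in C @^-1` D) = (C w \in D)); last by apply/idP/idP; rewrite !inE.
  by case: ifP => _; rewrite ?mule1// mule0 xsection0 measure0.
rewrite -copyE; apply: eq_integral => w _; rewrite /= xE indicE.
rewrite (_ : (w \in C @^-1` D) = (C w \in D)); last by apply/idP/idP; rewrite !inE.
by case: ifP => _; rewrite ?mule1// mule0 measure0.
Qed.

End copies.

Section test_level.
Context (R : realType) (n dX dY dZ B : nat) (sigma alpha : R).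
Local Open Scope ereal_scope.

Definition rejection (ss : B.-tuple (n.-tuple bool)) :
    set ((n.-tuple (dY.-tuple R) * n.-tuple (dZ.-tuple R)) *
         (n.-tuple (dX.-tuple R) * n.-tuple (dX.-tuple R))) :=
  [set t | (pvalue sigma (tnth t.2.1) (tnth t.2.2) (tnth t.1.1) (tnth t.1.2)
              (tnth ss) <= alpha)%R].

Lemma measurable_rejection ss : measurable (rejection ss).
Proof.
rewrite -[X in measurable X]setTI; apply: measurable_fun_le => //.
have mcomp d1 d2 d3 (S1 : measurableType d1) (S2 : measurableType d2)
    (S3 : measurableType d3) (f : S1 -> S2) (g : S2 -> S3) :
    measurable_fun setT f -> measurable_fun setT g -> measurable_fun setT (g \o f).
  by move=> mf mg; exact: measurableT_comp.
apply: (measurable_pvalue (X := fun i t => tnth t.2.1 i)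
  (X1 := fun i t => tnth t.2.2 i) (Y := fun i t => tnth t.1.1 i)
  (Z := fun i t => tnth t.1.2 i)) => i;
  apply: (measurableT_comp (measurable_tnth i)); exact: mcomp.
Qed.

Lemma xsection_rejection ss c : xsection (rejection ss) c =
  [set p | (pvalue sigma (tnth p.1) (tnth p.2) (tnth c.1) (tnth c.2)
              (tnth ss) <= alpha)%R].
Proof. by rewrite xsectionE. Qed.

Definition test_level : R := ((Num.floor (B.+1%:R * alpha))%:~R / B.+1%:R)%R.

(** The probability of any given value of the B seeds. *)
Definition seed_weight : R := ((2 ^+ n)^-1 ^+ B)%R.

Hypothesis alpha0 : (0 <= alpha)%R.

(** When the original and the copy are drawn from the same law, exchanging them
    according to further random bits s changes nothing. After this exchange the
    observed statistic and its B competitors are the values of one function at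
    B + 1 independent uniform bit vectors, and the observed one is among the k
    largest with probability at most k / (B + 1). The sum over s and over the
    seeds of that event is bounded pointwise before integrating. *)
Lemma avg_rejection_le c (m : 'I_n -> probability (dX.-tuple R) R) :
  \sum_(ss : B.-tuple (n.-tuple bool)) seed_weight%:E *
    (prod_prob m \x prod_prob m) (xsection (rejection ss) c) <= test_level%:E.
Proof.
set M := prod_prob m.
have mA ss : measurable (xsection (rejection ss) c).
  by apply: measurable_xsection; exact: measurable_rejection.
have mS s ss : measurable (swap_tuples s @^-1` xsection (rejection ss) c).
  by apply: measurable_preimageT => //; exact: measurable_swap_tuples.
have indicS s ss p : (\1_(swap_tuples s @^-1` xsection (rejection ss) c) p : R) =
    (pvalue sigma (tnth (swap_tuples s p).1) (tnth (swap_tuples s p).2)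
       (tnth c.1) (tnth c.2) (tnth ss) <= alpha)%R%:R.
  rewrite indicE; congr ((nat_of_bool _)%:R).
  by rewrite xsection_rejection; apply/idP/idP; rewrite inE.
have sumE : ((2 ^ n)%:R%:E * \sum_ss (M \x M) (xsection (rejection ss) c) =
    \int[M \x M]_p (\sum_(s : n.-tuple bool) \sum_(ss : B.-tuple (n.-tuple bool))
      (\1_(swap_tuples s @^-1` xsection (rejection ss) c) p)%:E)).
  rewrite ge0_integral_sum//; last 2 first.
  - move=> s; apply: emeasurable_sum => ss.
    by apply/measurable_EFinP; exact: measurable_indic.
  - by move=> s p _; apply: sume_ge0 => ss _; rewrite lee_fin.
  transitivity (\sum_(s : n.-tuple bool)
      \sum_ss (M \x M) (xsection (rejection ss) c)).
    rewrite sumr_const card_tuple card_bool -[RHS]mule_natl; congr (_ * _).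
  apply: eq_bigr => s _; rewrite ge0_integral_sum//; last first.
    by move=> ss; apply/measurable_EFinP; exact: measurable_indic.
  apply: eq_bigr => ss _; rewrite integral_indic// setIT.
  exact/esym/swap_tuples_invariant.
have boundE : (2 ^ n)%:R%:E * \sum_ss (M \x M) (xsection (rejection ss) c) <=
    (test_level * ((2 ^ n) ^ B.+1)%:R)%:E.
  rewrite sumE.
  apply: (@le_trans _ _ (\int[M \x M]_p (test_level * ((2 ^ n) ^ B.+1)%:R)%:E)).
    apply: ge0_le_integral => //.
    - by move=> p _; do 2 apply: sume_ge0 => ? _; rewrite lee_fin.
    - apply: emeasurable_sum => s; apply: emeasurable_sum => ss.
      by apply/measurable_EFinP; exact: measurable_indic.
    - move=> p _; under eq_bigr do rewrite sumEFin; rewrite sumEFin lee_fin.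
      have := sum_pvalue_le B sigma (tnth c.1) (tnth c.2) alpha0 p.
      rewrite -(ler_nat R) !natrM -ler_pdivlMl ?ltr0n//; move/le_trans.
      have -> : (B.+1%:R^-1 *
          (`|Num.floor (B.+1%:R * alpha)|%:R * ((2 ^ n) ^ B.+1)%:R) =
          test_level * ((2 ^ n) ^ B.+1)%:R)%R.
        rewrite natr_absz ger0_norm ?floor_ge0 ?mulr_ge0//.
        by rewrite /test_level mulrA; congr (_ * _)%R; rewrite mulrC.
      move=> /(_ _ (lexx _)); apply: le_trans; rewrite le_eqVlt; apply/orP; left.
      apply/eqP; rewrite natr_sum; apply: eq_bigr => s _.
      by rewrite natr_sum; apply: eq_bigr => ss _; rewrite indicS.
  rewrite [leLHS](integral_cst (M \x M)%E measurableT).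
  rewrite le_eqVlt; apply/orP; left; apply/eqP; rewrite -[RHS]mule1.
  congr (_ * _); exact: probability_setT.
have [S SE] : exists S : R, \sum_ss (M \x M) (xsection (rejection ss) c) = S%:E.
  exists (fine (\sum_ss (M \x M) (xsection (rejection ss) c))); rewrite fineK//.
  rewrite sum_fin_num; apply/allP => _ /mapP[ss _ ->].
  rewrite /= ge0_fin_numE ?measure_ge0//.
  by apply: le_lt_trans (ltry 1); exact: probability_le1.
rewrite -ge0_sume_distrr; last by move=> ss _; exact: measure_ge0.
move: boundE; rewrite SE -!EFinM !lee_fin /seed_weight expnS !natrM natrX.
rewrite mulrCA ler_pM2l ?exprn_gt0 ?ltr0n// !natrX exprVn => SB.
by rewrite mulrC ler_pdivrMr// exprn_gt0// exprn_gt0.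
Qed.

End test_level.

(** * Validity with estimated copies *)

Section inner_integral_split.
Context d (T : measurableType d) (R : realType) (mu : {measure set T -> \bar R}).
Local Open Scope ereal_scope.

(** The positive part of q - r is measurable and lies below e. *)
Lemma le_integral_add_inner (D : set T) (q r : T -> \bar R) (e : T -> \bar R) :
  measurable D -> measurable_fun setT q -> measurable_fun setT r ->
  (forall x, 0 <= q x) -> (forall x, 0 <= r x) ->
  (forall x, r x \is a fin_num) -> (forall x, 0 <= e x) ->
  (forall x, q x <= r x + e x) ->
  \int[mu]_(x in D) q x <= \int[mu]_(x in D) r x + \int[mu]_(x in D) e x.
Proof.
move=> mD mq mr q0 r0 rfin e0 qre.
pose h x := maxe (q x - r x) 0.
have mh : measurable_fun setT h.
  by apply: measurable_maxe => //; exact: emeasurable_funB.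
have h0 x : 0 <= h x by rewrite le_max lexx orbT.
apply: (@le_trans _ _ (\int[mu]_(x in D) (r x + h x))).
  apply: ge0_le_integral => //.
  - exact: measurable_funTS.
  - by apply: measurable_funTS; exact: emeasurable_funD.
  - by move=> x _; rewrite -leeBlDl// le_max lexx.
rewrite ge0_integralD//; [|exact: measurable_funTS..].
apply: leeD => //; apply: ge0_le_integral_inner => // x.
by rewrite ge_max e0 andbT leeBlDl.
Qed.

End inner_integral_split.

Section validity.
Context (R : realType) d0 (Omega : measurableType d0) (P : probability Omega R).
Context (n dX dY dZ B : nat) (sigma alpha : R) d1 (TW : measurableType d1).
Notation Xn := (n.-tuple (dX.-tuple R)).
Notation Yn := (n.-tuple (dY.-tuple R)).
Notation Zn := (n.-tuple (dZ.-tuple R)).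
Variables (X_ X1_ : 'I_n -> Omega -> dX.-tuple R)
  (Y_ : 'I_n -> Omega -> dY.-tuple R) (Z_ : 'I_n -> Omega -> dZ.-tuple R)
  (W : Omega -> TW) (pi_ : 'I_B -> Omega -> n.-tuple bool).
Hypotheses (mX : forall i, measurable_fun setT (X_ i))
  (mX1 : forall i, measurable_fun setT (X1_ i))
  (mY : forall i, measurable_fun setT (Y_ i))
  (mZ : forall i, measurable_fun setT (Z_ i))
  (mW : measurable_fun setT W) (mpi : forall b, measurable_fun setT (pi_ b)).
Variables (kappa : dZ.-tuple R -> probability (dX.-tuple R) R)
  (Q : TW -> Zn -> probability Xn R).
Let PX (z : Zn) : probability Xn R := prod_prob (fun i => kappa (tnth z i)).
Let Xs := rvtuple X_.
Let X1s := rvtuple X1_.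
Let Ys := rvtuple Y_.
Let Zs := rvtuple Z_.
Let C4 w := (Xs w, Ys w, Zs w, W w).
Hypothesis alpha0 : 0 <= alpha.
Hypothesis lawX1 : disintegrates P C4 X1s (fun c => Q c.2 c.1.2).
Hypothesis indpi : mutual_indep P pi_.
Hypothesis unifpi : forall b, uniform_bits P (pi_ b).
Hypothesis indpiV : indep P (rvtuple pi_) (fun w => (C4 w, X1s w)).
Let p w : R := pvalue sigma (X_ ^~ w) (X1_ ^~ w) (Y_ ^~ w) (Z_ ^~ w) (pi_ ^~ w).
Local Open Scope ereal_scope.

Let rej := @rejection R n dX dY dZ B sigma alpha.
Let wgt := @seed_weight R n B.
Let lvl := @test_level R B alpha.

Let mXs : measurable_fun setT Xs. Proof. exact: measurable_rvtuple. Qed.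
Let mX1s : measurable_fun setT X1s. Proof. exact: measurable_rvtuple. Qed.
Let mYs : measurable_fun setT Ys. Proof. exact: measurable_rvtuple. Qed.
Let mZs : measurable_fun setT Zs. Proof. exact: measurable_rvtuple. Qed.
Let mC4 : measurable_fun setT C4.
Proof. by do 3 apply: measurable_fun_pair => //. Qed.

Let wgt_ge0 : (0 <= wgt)%R.
Proof. by rewrite exprn_ge0// invr_ge0 exprn_ge0. Qed.

Let sum_wgt : \sum_(ss : B.-tuple (n.-tuple bool)) wgt%:E = 1.
Proof.
rewrite sumEFin sumr_const card_tuple card_tuple card_bool -mulr_natl; congr EFin.
by rewrite !natrX /wgt /seed_weight exprVn mulfV// expf_neq0// expf_neq0.
Qed.

Let rvtupleE (T : Type) m (U : 'I_m -> Omega -> T) w : tnth (rvtuple U w) = U ^~ w.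
Proof. by apply/funext => i; rewrite tnth_mktuple. Qed.

Let rejE w : (p w <= alpha)%R = (rej (rvtuple pi_ w) ((Ys w, Zs w), (Xs w, X1s w))) :> Prop.
Proof. by rewrite /rej /rejection /= !rvtupleE. Qed.

Let q (ss : B.-tuple (n.-tuple bool)) (c : Xn * Yn * Zn * TW) : \bar R :=
  Q c.2 c.1.2 (xsection (xsection (rej ss) (c.1.1.2, c.1.2)) c.1.1.1).

Let E4 (ss : B.-tuple (n.-tuple bool)) : set (Xn * Yn * Zn * TW * Xn) :=
  [set t | rej ss ((t.1.1.1.2, t.1.1.2), (t.1.1.1.1, t.2))].

Let mE4 ss : measurable (E4 ss).
Proof.
apply: (measurable_preimageT (f := fun t : Xn * Yn * Zn * TW * Xn =>
  ((t.1.1.1.2, t.1.1.2), (t.1.1.1.1, t.2)))); last exact: measurable_rejection.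
have m1 : measurable_fun setT (fun t : Xn * Yn * Zn * TW * Xn => t.1.1).
  exact: (measurableT_comp measurable_fst measurable_fst).
have m2 : measurable_fun setT (fun t : Xn * Yn * Zn * TW * Xn => t.1.1.1).
  exact: (measurableT_comp measurable_fst m1).
apply: measurable_fun_pair; apply: measurable_fun_pair => //.
- exact: (measurableT_comp measurable_snd m2).
- exact: (measurableT_comp measurable_snd m1).
- exact: (measurableT_comp measurable_fst m2).
Qed.

Let xsectionE4 ss c : xsection (E4 ss) c =
  xsection (xsection (rej ss) (c.1.1.2, c.1.2)) c.1.1.1.
Proof. by rewrite !xsectionE. Qed.

Let mq ss : measurable_fun setT (q ss).
Proof.
have [+ _] := lawX1 (mE4 ss).
by under eq_fun do rewrite xsectionE4.
Qed.

(** The seeds are independent of the data and uniform, so they are averaged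
    out; for fixed seeds the copies are averaged against their conditional law. *)
Lemma rejection_probability (F : set (Xn * Yn * Zn * TW)) : measurable F ->
  P ([set w | (p w <= alpha)%R] `&` C4 @^-1` F) =
  \sum_ss wgt%:E * \int[P]_(w in C4 @^-1` F) q ss (C4 w).
Proof.
move=> mF; pose G ss := E4 ss `&` (F `*` setT).
have mG ss : measurable (G ss) by apply: measurableI => //; exact: measurableX.
transitivity (P [set w | G (rvtuple pi_ w) (C4 w, X1s w)]).
  congr (P _); apply/seteqP; split=> w /=; rewrite /= rejE.
    by case=> ? ?; split.
  by case=> ? [].
rewrite (probability_random_selection (G := G) (V := fun w => (C4 w, X1s w)))//; last first.
  exact: measurable_fun_pair.
apply: eq_bigr => ss _; congr (_ * _); rewrite (lawX1 (mG ss)).2.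
rewrite [RHS]integral_mkcond epatch_indic; apply: eq_integral => w _ /=.
rewrite xsectionI xsectionE4 indicE.
rewrite (_ : (w \in C4 @^-1` F) = (C4 w \in F)); last by apply/idP/idP; rewrite !inE.
have [wF|wF] := boolP (C4 w \in F); first by rewrite in_xsectionX// setIT mule1.
by rewrite notin_xsectionX// setI0 measure0 mule0.
Qed.

Let measurable_rejection_event : measurable [set w | (p w <= alpha)%R].
Proof.
rewrite (_ : [set w | _] = [set w | E4 (rvtuple pi_ w) (C4 w, X1s w)]).
  apply: (measurable_random_selection (G := E4) (V := fun w => (C4 w, X1s w))) => //.
  exact: measurable_fun_pair.
by apply/seteqP; split=> w /=; rewrite rejE.
Qed.

Let dtv (z : Zn) (w : TW) : \bar R := dTV (Q w z) (PX z).
Let dtv_ge0 z w : 0 <= dtv z w. Proof. exact: dTV_ge0. Qed.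

(** Given (Y, Z, W) the original and the copy are independent with laws PX and
    Q, so the conditional rejection probability is almost surely an average of
    product masses. Replacing Q by PX inside each of them costs at most the
    distance and leaves the exchangeable situation. *)
Lemma validity_given_data (f : Yn * Zn * TW -> \bar R) :
  disintegrates P (fun w => (Ys w, Zs w, W w)) Xs (fun c => PX c.1.2) ->
  cond_prob_version P (fun w => (Ys w, Zs w, W w)) [set w | (p w <= alpha)%R] f ->
  {ae P, forall w, f (Ys w, Zs w, W w) <= lvl%:E + dtv (Zs w) (W w)}.
Proof.
move=> lawX vf; pose C' w := (Ys w, Zs w, W w).
have mC' : measurable_fun setT C' by do 2 apply: measurable_fun_pair => //.
pose E3 ss : set ((Yn * Zn * TW) * (Xn * Xn)) := [set t | rej ss (t.1.1, t.2)].
have mE3 ss : measurable (E3 ss).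
  apply: (measurable_preimageT
    (f := fun t : (Yn * Zn * TW) * (Xn * Xn) => (t.1.1, t.2))).
    apply: measurable_fun_pair => //.
    exact: (measurableT_comp measurable_fst measurable_fst).
  exact: measurable_rejection.
have xE3 ss c : xsection (E3 ss) c = xsection (rej ss) c.1 by rewrite !xsectionE.
(* Measurability of Q in (z, w) is read off from its measurability in
   (x, y, z, w) at an arbitrary fixed x. *)
pose x0 : Xn := [tuple [tuple 0%R | _ < dX] | _ < n].
have mQ A : measurable A ->
    measurable_fun setT (fun c : Yn * Zn * TW => Q c.2 c.1.2 A).
  move=> mA; have mQA := disintegrates_meas lawX1 mA.
  have mx0 : measurable_fun setT (fun c : Yn * Zn * TW => (x0, c.1.1, c.1.2, c.2)).
    apply: measurable_fun_pair => //; apply: measurable_fun_pair.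
      apply: measurable_fun_pair => //.
      exact: (measurableT_comp measurable_fst measurable_fst).
    exact: (measurableT_comp measurable_snd measurable_fst).
  exact: (measurableT_comp mQA mx0).
pose F (c : Yn * Zn * TW) : \bar R := \sum_ss wgt%:E *
  (PX c.1.2 \x Q c.2 c.1.2) (xsection (rej ss) c.1).
have mprod ss : measurable_fun setT (fun c : Yn * Zn * TW =>
    (PX c.1.2 \x Q c.2 c.1.2) (xsection (rej ss) c.1)).
  have [_ + _] := disintegrates_copy mC' mXs lawX mQ (mE3 ss).
  by under eq_fun do rewrite xE3.
have vF : cond_prob_version P C' [set w | (p w <= alpha)%R] F.
  split.
    by apply: emeasurable_sum => ss; exact: measurable_funeM.
  move=> D mD; have mCD := measurable_preimageT mC' mD.
  pose th (c : Xn * Yn * Zn * TW) := (c.1.1.2, c.1.2, c.2).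
  have mth : measurable_fun setT th.
    apply: measurable_fun_pair => //; apply: measurable_fun_pair.
      apply: (measurableT_comp measurable_snd).
      exact: (measurableT_comp measurable_fst measurable_fst).
    exact: (measurableT_comp measurable_snd measurable_fst).
  rewrite integral_indic//.
  rewrite [RHS](rejection_probability (measurable_preimageT mth mD)).
  have mprodC ss : measurable_fun setT (fun w =>
      (PX (Zs w) \x Q (W w) (Zs w)) (xsection (rej ss) (Ys w, Zs w))).
    exact: (measurableT_comp (mprod ss) mC').
  rewrite ge0_integral_sum//; last 2 first.
  - by move=> ss; apply: measurable_funTS; exact: measurable_funeM.
  - by move=> ss w _; rewrite mule_ge0// ?lee_fin.
  apply: eq_bigr => ss _; rewrite ge0_integralZl//; last first.
    exact: (measurable_funTS (mprodC ss)).
  congr (_ * _).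
  transitivity (\int[P]_(w in C' @^-1` D)
      (PX (Zs w) \x Q (W w) (Zs w)) (xsection (E3 ss) (C' w))).
    by apply: eq_integral => w _; congr (_ _); exact/esym/xE3.
  apply: (etrans (esym (disintegrates_copy_on mC' mXs lawX mQ (mE3 ss) mD))).
  by apply: eq_integral => w _; congr (Q _ _ (xsection _ _)); exact: xE3.
have fF : {ae P, forall w, f (C' w) = F (C' w)}.
  apply: (ae_eq_version mC' _ vf vF) => D mD.
  exact: integral_indic_bounds.
apply: filterS fF => w ->; rewrite /F /=.
have mrs ss : measurable (xsection (rej ss) (Ys w, Zs w)).
  by apply: measurable_xsection; exact: measurable_rejection.
apply: (@le_trans _ _ (\sum_ss (wgt%:E *
    (PX (Zs w) \x PX (Zs w)) (xsection (rej ss) (Ys w, Zs w)) +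
    wgt%:E * dtv (Zs w) (W w)))).
  apply: lee_sum => ss _; rewrite -ge0_muleDr//.
  rewrite lee_wpmul2l ?lee_fin//; exact: product_le_dTV.
rewrite big_split/= -ge0_sume_distrl ?sum_wgt ?mul1e; last by move=> ss _; rewrite lee_fin.
by rewrite leeD2r//; exact: avg_rejection_le.
Qed.

(** W may depend on the originals here, so Q is replaced by PX first, for fixed
    originals, where the distance is a function of (Z, W). Only then are the
    originals averaged out, against a draw from PX that depends on Z alone. *)
Lemma validity_averaged (f g : Yn * Zn -> \bar R) :
  disintegrates P (fun w => (Ys w, Zs w)) Xs (fun c => PX c.2) ->
  cond_prob_version P (fun w => (Ys w, Zs w)) [set w | (p w <= alpha)%R] f ->
  cond_exp_version P (fun w => (Ys w, Zs w)) (fun w => dtv (Zs w) (W w)) g ->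
  {ae P, forall w, f (Ys w, Zs w) <= lvl%:E + g (Ys w, Zs w)}.
Proof.
move=> lawX vf vg; pose C w := (Ys w, Zs w).
have mC : measurable_fun setT C by exact: measurable_fun_pair.
have mrej ss : measurable (rej ss) by exact: measurable_rejection.
have mPX A : measurable A -> measurable_fun setT (fun c : Yn * Zn => PX c.2 A).
  exact: disintegrates_meas lawX.
pose r ss w := PX (Zs w) (xsection (xsection (rej ss) (C w)) (Xs w)).
pose rr ss w := (PX (Zs w) \x PX (Zs w)) (xsection (rej ss) (C w)).
have mr ss : measurable_fun setT (r ss).
  have [mphi _ _] := disintegrates_copy mC mXs lawX mPX (mrej ss).
  have mCX : measurable_fun setT (fun w => (C w, Xs w)) by exact: measurable_fun_pair.
  exact: (measurableT_comp mphi mCX).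
have mrr ss : measurable_fun setT (rr ss).
  have [_ mphi _] := disintegrates_copy mC mXs lawX mPX (mrej ss).
  exact: (measurableT_comp mphi mC).
have mx ss w : measurable (xsection (xsection (rej ss) (C w)) (Xs w)).
  by apply: measurable_xsection; exact: measurable_xsection.
have mqC ss : measurable_fun setT (fun w => q ss (C4 w)).
  exact: (measurableT_comp (mq ss) mC4).
have dtv_bounds D : measurable D ->
    0 <= \int[P]_(w in C @^-1` D) dtv (Zs w) (W w) < +oo.
  move=> mD; rewrite integral_ge0//=.
  apply: (@le_lt_trans _ _ (\int[P]_(w in C @^-1` D) cst 1 w)).
    by apply: ge0_le_integral_inner => // w; exact: dTV_le1.
  have mCD := measurable_preimageT mC mD.
  by rewrite integral_cst//= mul1e (le_lt_trans (probability_le1 _ _)) ?ltry.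
have f_bounds D : measurable D -> 0 <= \int[P]_(w in C @^-1` D) f (C w) < +oo.
  by move=> mD; rewrite vf.2//; exact: integral_indic_bounds.
have intf := version_integrable mC vf.1 f_bounds.
have intg : P.-integrable setT (g \o C).
  by apply: version_integrable vg.1 _ => // D mD; rewrite vg.2//; exact: dtv_bounds.
have intlg : P.-integrable setT ((fun c => lvl%:E + g c) \o C).
  apply: integrableD => //; exact: finite_measure_integrable_cst.
have mlg : measurable_fun setT (fun c => lvl%:E + g c).
  by apply: emeasurable_funD => //; exact: vg.1.
apply: (ae_le_version mC vf.1 mlg intf intlg) => D mD.
have mCD := measurable_preimageT mC mD.
rewrite (@integralD _ _ _ P _ mCD (cst lvl%:E) (g \o C)); last 2 first.
- exact: finite_measure_integrable_cst.
- exact: integrableS intg.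
rewrite vg.2// vf.2// integral_indic//.
pose th (c : Xn * Yn * Zn * TW) := (c.1.1.2, c.1.2).
have mth : measurable_fun setT th.
  apply: measurable_fun_pair.
    apply: (measurableT_comp measurable_snd).
    exact: (measurableT_comp measurable_fst measurable_fst).
  exact: (measurableT_comp measurable_snd measurable_fst).
rewrite [leLHS](rejection_probability (measurable_preimageT mth mD)).
set I := \int[P]_(w in C @^-1` D) dtv (Zs w) (W w).
have I0 : 0 <= I by case/andP: (dtv_bounds D mD).
apply: (@le_trans _ _ (\sum_ss (wgt%:E * \int[P]_(w in C @^-1` D) rr ss w +
                                wgt%:E * I))).
  apply: lee_sum => ss _; rewrite -ge0_muleDr//; last exact: integral_ge0.
  rewrite lee_wpmul2l ?lee_fin//.
  have <- : \int[P]_(w in C @^-1` D) r ss w = \int[P]_(w in C @^-1` D) rr ss w.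
    exact: (disintegrates_copy_on mC mXs lawX mPX (mrej ss) mD).
  apply: le_integral_add_inner => //.
  - by move=> w; exact: fin_num_measure.
  - by move=> w; exact: (le_dTV (Q (W w) (Zs w)) (PX (Zs w)) (mx ss w)).
rewrite big_split/= -ge0_sume_distrl ?sum_wgt ?mul1e; last by move=> ss _; rewrite lee_fin.
apply: leeD => //.
have -> : \sum_ss wgt%:E * \int[P]_(w in C @^-1` D) rr ss w =
          \int[P]_(w in C @^-1` D) (\sum_ss wgt%:E * rr ss w).
  rewrite ge0_integral_sum//; last 2 first.
  - by move=> ss; apply: measurable_funTS; exact: measurable_funeM.
  - by move=> ss w _; rewrite mule_ge0// lee_fin.
  apply: eq_bigr => ss _; rewrite ge0_integralZl// ?lee_fin//.
  exact: (measurable_funTS (mrr ss)).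
apply: ge0_le_integral => //.
- by move=> w _; apply: sume_ge0 => ss _; rewrite mule_ge0// lee_fin.
- by apply: measurable_funTS; apply: emeasurable_sum => ss; exact: measurable_funeM.
- by move=> w _; exact: avg_rejection_le.
Qed.

End validity.

(** Each X_i has the law kappa (Z_i) given (Z_i, Y_i), as X given (Z, Y) does
    by conditional independence; the coordinates are then put together and the
    sample of pairs is unzipped into a pair of samples. *)
Lemma disintegrates_sample (R : realType) d0 (Omega : measurableType d0)
    (P : probability Omega R) d1 (TX : measurableType d1)
    d2 (TY : measurableType d2) d3 (TZ : measurableType d3) n
    (X : Omega -> TX) (Y : Omega -> TY) (Z : Omega -> TZ)
    (X_ : 'I_n -> Omega -> TX) (Y_ : 'I_n -> Omega -> TY)
    (Z_ : 'I_n -> Omega -> TZ) (kappa : TZ -> probability TX R) :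
  measurable_fun setT X -> measurable_fun setT Y -> measurable_fun setT Z ->
  (forall i, measurable_fun setT (X_ i)) ->
  (forall i, measurable_fun setT (Y_ i)) ->
  (forall i, measurable_fun setT (Z_ i)) ->
  iid_sample_of P (fun i w => (X_ i w, Y_ i w, Z_ i w))
                  (fun w => (X w, Y w, Z w)) ->
  cond_indep P X Y Z -> disintegrates P Z X kappa ->
  disintegrates P (fun w => (rvtuple Y_ w, rvtuple Z_ w)) (rvtuple X_)
    (fun c => prod_prob (fun i => kappa (tnth c.2 i))).
Proof.
move=> mX mY mZ mX_ mY_ mZ_ [ind law] ci dis.
have disZY := disintegrates_cond_indep mZ mX mY dis ci.
pose g (t : TX * TY * TZ) : (TZ * TY) * TX := ((t.2, t.1.2), t.1.1).
have mg : measurable_fun setT g.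
  apply: measurable_fun_pair; first apply: measurable_fun_pair => //.
    exact: (measurableT_comp measurable_snd measurable_fst).
  exact: (measurableT_comp measurable_fst measurable_fst).
have mZY_ i : measurable_fun setT (fun w => (Z_ i w, Y_ i w)).
  exact: measurable_fun_pair.
have mkappa A : measurable A -> measurable_fun setT (fun c => kappa c A).
  exact: disintegrates_meas dis.
have mkappa1 A : measurable A ->
    measurable_fun setT (fun c : TZ * TY => kappa c.1 A).
  by move=> mA; exact: (measurableT_comp (mkappa A mA) measurable_fst).
have dis_ i : disintegrates P (fun w => (Z_ i w, Y_ i w)) (X_ i)
    (fun c : TZ * TY => kappa c.1).
  apply: (disintegrates_same_law _ (mZY_ i) _ disZY).
    exact: measurable_fun_pair.
  exact: (same_law_comp mg (law i)).
have disn := disintegrates_iid mZY_ mX_ (mutual_indep_comp mg ind) dis_ mkappa1.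
pose psi (v : n.-tuple (TZ * TY)) : n.-tuple TY * n.-tuple TZ :=
  ([tuple (tnth v i).2 | i < n], [tuple (tnth v i).1 | i < n]).
pose phi (c : n.-tuple TY * n.-tuple TZ) : n.-tuple (TZ * TY) :=
  [tuple (tnth c.2 i, tnth c.1 i) | i < n].
have mpsi : measurable_fun setT psi.
  apply: measurable_fun_pair; apply/measurable_fun_tnthP => i.
    rewrite (_ : _ \o _ = fun v : n.-tuple (TZ * TY) => (tnth v i).2).
      exact: (measurableT_comp measurable_snd (measurable_tnth i)).
    by apply/funext => v /=; rewrite tnth_mktuple.
  rewrite (_ : _ \o _ = fun v : n.-tuple (TZ * TY) => (tnth v i).1).
    exact: (measurableT_comp measurable_fst (measurable_tnth i)).
  by apply/funext => v /=; rewrite tnth_mktuple.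
have mphi : measurable_fun setT phi.
  apply/measurable_fun_tnthP => i.
  rewrite (_ : _ \o _ = fun c => (tnth c.2 i, tnth c.1 i)).
    apply: measurable_fun_pair.
      exact: (measurableT_comp (measurable_tnth i) measurable_snd).
    exact: (measurableT_comp (measurable_tnth i) measurable_fst).
  by apply/funext => v /=; rewrite tnth_mktuple.
have phiK : cancel phi psi.
  move=> [y z]; congr (_, _); apply: eq_from_tnth => i;
  by rewrite !tnth_mktuple.
have -> : (fun w => (rvtuple Y_ w, rvtuple Z_ w)) =
          psi \o rvtuple (fun i w => (Z_ i w, Y_ i w)).
  by apply/funext => w; congr (_, _); apply: eq_from_tnth => i;
    rewrite !tnth_mktuple.
apply: (disintegrates_map mpsi mphi phiK).
rewrite (_ : _ \o psi = fun v : n.-tuple (TZ * TY) =>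
  prod_prob (fun i => kappa (tnth v i).1))//.
apply/funext => v /=; congr prod_prob; apply/funext => i.
by rewrite tnth_mktuple.
Qed.

Theorem theorem5p1 (R : realType)
    (d0 : measure_display) (Omega : measurableType d0)
    (P : probability Omega R)
    (n dX dY dZ B : nat) (sigma alpha : R)
    (* the random vector (X, Y, Z) and the sample *)
    (X : {mfun Omega >-> dX.-tuple R})
    (Y : {mfun Omega >-> dY.-tuple R})
    (Z : {mfun Omega >-> dZ.-tuple R})
    (X_ : 'I_n -> {mfun Omega >-> dX.-tuple R})
    (Y_ : 'I_n -> {mfun Omega >-> dY.-tuple R})
    (Z_ : 'I_n -> {mfun Omega >-> dZ.-tuple R})
    (* the true conditional distribution of X given Z *)
    (PXZ : R.-pker (dZ.-tuple R) ~> (dX.-tuple R))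
    (* the data W from which the estimate is computed, the estimate
       Q (W, z) of PXZ z, and the copies drawn from it *)
    (d1 : measure_display) (TW : measurableType d1)
    (W : {mfun Omega >-> TW})
    (Q : R.-pker (TW * dZ.-tuple R)%type ~> (dX.-tuple R))
    (X1_ : 'I_n -> {mfun Omega >-> dX.-tuple R})
    (pi_ : 'I_B -> {mfun Omega >-> n.-tuple bool}) :
  (1 < n)%N -> 0 < sigma ^+ 2 -> 0 <= alpha <= 1 ->
  iid_sample_of P (fun i w => (X_ i w, Y_ i w, Z_ i w))
                  (fun w => (X w, Y w, Z w)) ->
  cond_indep P X Y Z ->
  cond_law P X Z (kernel_prob PXZ) ->
  let Xs := rvtuple X_ in let Ys := rvtuple Y_ in let Zs := rvtuple Z_ in
  let X1s := rvtuple X1_ in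
  let PXZn (z : n.-tuple (dZ.-tuple R)) :=
    prod_prob (fun i => kernel_prob PXZ (tnth z i)) in
  let QXZn (q : TW) (z : n.-tuple (dZ.-tuple R)) :=
    prod_prob (fun i => kernel_prob Q (q, tnth z i)) in
  cond_law P X1s (fun w => (Xs w, Ys w, Zs w, W w))
    (fun c => let: (_, _, z, q) := c in QXZn q z) ->
  mutual_indep P pi_ ->
  (forall b, uniform_bits P (pi_ b)) ->
  indep P (rvtuple pi_) (fun w => (Xs w, Ys w, Zs w, W w, X1s w)) ->
  let p (w : Omega) : R :=
    pvalue sigma (X_ ^~ w) (X1_ ^~ w) (Y_ ^~ w) (Z_ ^~ w) (pi_ ^~ w) in
  let level : R := (Num.floor (B.+1%:R * alpha))%:~R / B.+1%:R in
  (* the estimate is computed from (Y_i, Z_i)_i and from data which, given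
     those, are independent of (X_i)_i; it is held fixed by the conditioning *)
  (cond_indep P Xs W (fun w => (Ys w, Zs w)) ->
   forall f,
     cond_prob_version P (fun w => (Ys w, Zs w, W w))
       [set w | p w <= alpha] f ->
     {ae P, forall w, (f (Ys w, Zs w, W w)
       <= level%:E + dTV (QXZn (W w) (Zs w)) (PXZn (Zs w)))%E})
  /\
  (* the estimate may also use (X_i)_i, so that the distance is still random
     given (Y_i, Z_i)_i and is averaged *)
  (forall f g,
     cond_prob_version P (fun w => (Ys w, Zs w)) [set w | p w <= alpha] f ->
     cond_exp_version P (fun w => (Ys w, Zs w))
       (fun w => dTV (QXZn (W w) (Zs w)) (PXZn (Zs w))) g ->
     {ae P, forall w, (f (Ys w, Zs w) <= level%:E + g (Ys w, Zs w))%E}).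
Proof.
move=> _ _ /andP[alpha0 _] iid ci lawX Xs Ys Zs X1s PXZn QXZn lawX1 indpi unifpi.
move=> indpiV p level.
have mX i : measurable_fun setT (X_ i) by [].
have mY i : measurable_fun setT (Y_ i) by [].
have mZ i : measurable_fun setT (Z_ i) by [].
have mX1 i : measurable_fun setT (X1_ i) by [].
have mpi b : measurable_fun setT (pi_ b) by [].
have mW : measurable_fun setT W by [].
have mXs : measurable_fun setT Xs by exact: measurable_rvtuple.
have mYs : measurable_fun setT Ys by exact: measurable_rvtuple.
have mZs : measurable_fun setT Zs by exact: measurable_rvtuple.
have mX1s : measurable_fun setT X1s by exact: measurable_rvtuple.
have disX : disintegrates P (fun w => (Ys w, Zs w)) Xs (fun c => PXZn c.2).
  apply: (disintegrates_sample (kappa := fun z => kernel_prob PXZ z) _ _ _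
    mX mY mZ iid ci) => //.
  exact: (cond_law_disintegrates (kappa := fun z => kernel_prob PXZ z)).
have disX1 : disintegrates P (fun w => (Xs w, Ys w, Zs w, W w)) X1s
    (fun c => QXZn c.2 c.1.2).
  apply: cond_law_disintegrates => //.
  - by do 3 apply: measurable_fun_pair => //.
  - rewrite (_ : (fun c => _) = fun c => let: (_, _, z, q) := c in
      QXZn q z : set _ -> _)//.
    by apply/funext => -[[[]]].
split.
  move=> ciW f vf.
  apply: (validity_given_data mX mX1 mY mZ mW mpi alpha0 disX1 indpi unifpi
    indpiV _ vf).
  apply: (disintegrates_cond_indep _ _ _ disX ciW) => //.
  exact: measurable_fun_pair.
move=> f g vf vg.
exact: (validity_averaged mX mX1 mY mZ mW mpi alpha0 disX1 indpi unifpi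
  indpiV disX vf vg).
Qed.
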